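(* Let $(M,h)$ be a Riemannian manifold of dimension $n\ge 3$ with a fixed spin structure, and denote by $\mathrm{scal}$, $\mathrm{Ric}$ and $D$ the scalar curvature, the Ricci curvature, and the Dirac operator with respect to $h$. Then the operator $L_1$ (acting on spinors) defined by $$L_1:=D^3-\frac{\mathrm{cl}(d(\mathrm{scal}))}{2(n-1)}-\frac{2\,\mathrm{cl}\circ\mathrm{Ric}\circ\nabla}{n-2}+\frac{\mathrm{scal}}{(n-1)(n-2)}D$$ is a natural conformally covariant differential operator: for every $\omega\in C^\infty(M)$, $$\hat L_1=e^{-\frac{n+3}{2}\omega}\,L_1\,e^{\frac{n-3}{2}\omega}$$ if $\hat L_1$ is defined by the same formula in terms of the conformal metric $\hat h=e^{2\omega}h$.
   Context: $\mathrm{cl}$ denotes Clifford multiplication, with $\mathrm{cl}(v)^2=-|v|^2$ (covectors identified with vectors by the metric); $\nabla$ is the spinor connection induced by the Levi-Civita connection; in a local orthonormal frame $(e_i)$, $D=\sum_i\mathrm{cl}(e_i)\nabla_{e_i}$ and $\mathrm{cl}\circ\mathrm{Ric}\circ\nabla=\sum_{i,j}\mathrm{Ric}_{ij}\,\mathrm{cl}(e_i)\nabla_{e_j}$. The spinor bundles of $h$ and $\hat h$ (for the same spin structure) are identified by the standard fibrewise isometry for conformal metrics. Natural means given by a universal expression in the metric, its curvature and covariant derivatives, and Clifford multiplication. *)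

(* Defs.v *)
From HB Require Import structures.
From mathcomp Require Import all_boot all_order all_algebra.
From mathcomp Require Import all_classical all_reals all_analysis.
From mathcomp Require Import perm complex.
Set Implicit Arguments.
Unset Strict Implicit.
Unset Printing Implicit Defensive.
Import Order.TTheory GRing.Theory Num.Theory.
Import numFieldNormedType.Exports.
Local Open Scope classical_set_scope.
Local Open Scope ring_scope.

Section Smooth.
Variables (R : realType) (m : nat).

(* For open U, Ck_on k U f for all k is the usual C^infinity: all iterated
   partial derivatives exist and are continuous.  Asking for Frechet
   differentiability at each stage makes the chain rule directly available. *)
Fixpoint Ck_on (k : nat) (U : set 'rV[R]_m) (f : 'rV[R]_m -> R) : Prop :=
  if k is k'.+1 then
    (forall y, U y -> differentiable f y) /\
    (forall v : 'rV[R]_m, Ck_on k' U (fun y => 'D_v f y))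
  else forall y, U y -> {for y, continuous f}.

Definition Cinf_on (U : set 'rV[R]_m) (f : 'rV[R]_m -> R) : Prop :=
  forall k, Ck_on k U f.

End Smooth.

(* Local geometry on an open subset of R^n.  h is the Gram matrix of the metric
   in the coordinates, e an h-orthonormal frame, X, Y, Z are vector fields
   (rows of components), g are the Clifford matrices of the standard basis of
   R^n acting on the fibre C^N. A spinor is given by its components with respect
   to the spin frame lying over e, so that cl(e_i) is the constant matrix g i. *)
Section Local.
Variables (R : realType) (n N : nat).
Variables (h : 'rV[R]_n -> 'M[R]_n) (e : 'I_n -> 'rV[R]_n -> 'rV[R]_n).
Variable (g : 'I_n -> 'M[R[i]]_N).

Notation point := 'rV[R]_n.
Notation vfield := ('rV[R]_n -> 'rV[R]_n).
Notation spin := ('rV[R]_n -> 'cV[R[i]]_N).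

Definition inner (X Y : vfield) (y : point) : R :=
  (X y *m h y *m (Y y)^T) 0 0.

Definition act (X : vfield) (f : point -> R) (y : point) : R := 'D_(X y) f y.

Definition bracket (X Y : vfield) : vfield :=
  fun y => 'D_(X y) Y y - 'D_(Y y) X y.

(* h (nabla_X Y, Z) for the Levi-Civita connection (Koszul formula). *)
Definition koszul (X Y Z : vfield) (y : point) : R :=
  2^-1 * (act X (inner Y Z) y + act Y (inner Z X) y - act Z (inner X Y) y
    + inner (bracket X Y) Z y - inner (bracket Y Z) X y
    + inner (bracket Z X) Y y).

Definition levi_civita (X Y : vfield) : vfield :=
  fun y => \sum_(k < n) koszul X Y (e k) y *: e k y.

Definition riem (X Y Z : vfield) : vfield :=
  fun y => levi_civita X (levi_civita Y Z) y - levi_civita Y (levi_civita X Z) y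
           - levi_civita (bracket X Y) Z y.

(* Trace of X |-> riem X Y Z; positive on round spheres. *)
Definition ric (Y Z : vfield) (y : point) : R :=
  \sum_(k < n) inner (riem (e k) Y Z) (e k) y.

Definition scal (y : point) : R := \sum_(k < n) ric (e k) (e k) y.

Definition act_spin (X : vfield) (psi : spin) : spin :=
  fun y => \col_k Complex (act X (fun z => complex.Re (psi z k 0)) y)
                          (act X (fun z => complex.Im (psi z k 0)) y).

(* The sign of the 1/4-term is the one for which
   nabla_X (cl Y psi) = cl (nabla_X Y) psi + cl Y (nabla_X psi)
   when cl(v)^2 = - |v|^2. *)
Definition nabla (X : vfield) (psi : spin) : spin :=
  fun y => act_spin X psi y
    + (4^-1)%:C%C *: (\sum_(j < n) \sum_(k < n)
         (inner (levi_civita X (e j)) (e k) y)%:C%C *: (g j *m g k *m psi y)).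

Definition dirac (psi : spin) : spin :=
  fun y => \sum_(i < n) g i *m nabla (e i) psi y.

Definition cl_grad (f : point -> R) (psi : spin) : spin :=
  fun y => \sum_(i < n) (act (e i) f y)%:C%C *: (g i *m psi y).

Definition cl_ric_nabla (psi : spin) : spin :=
  fun y => \sum_(i < n) \sum_(j < n)
    (ric (e i) (e j) y)%:C%C *: (g i *m nabla (e j) psi y).

Definition L1_loc (psi : spin) : spin :=
  fun y => dirac (dirac (dirac psi)) y
    - ((2 * (n%:R - 1))^-1)%:C%C *: cl_grad scal psi y
    - (2 / (n%:R - 2))%:C%C *: cl_ric_nabla psi y
    + (scal y / ((n%:R - 1) * (n%:R - 2)))%:C%C *: dirac psi y.

(* Spinor-valued covariant k-tensors, by their components in the frame e. *)
Definition tspin (k : nat) := k.-tuple 'I_n -> spin.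

Definition tnabla (k : nat) (T : tspin k) : tspin k.+1 :=
  fun J y => let i := thead J in let K := [tuple of behead J] in
    nabla (e i) (T K) y
    - \sum_(p < k) \sum_(q < n)
        (inner (levi_civita (e i) (e (tnth K p))) (e q) y)%:C%C
        *: T [tuple (if r == p then q else tnth K r) | r < k] y.

Definition triem (k : nat) (T : tspin k) : tspin k.+4 :=
  fun J y => let J1 := [tuple of behead J] in let J2 := [tuple of behead J1] in
    let J3 := [tuple of behead J2] in
    (inner (riem (e (thead J)) (e (thead J1)) (e (thead J2)))
           (e (thead J3)) y)%:C%C *: T [tuple of behead J3] y.

Definition tmetric (k : nat) (T : tspin k) : tspin k.+2 :=
  fun J y => let J1 := [tuple of behead J] in
    (inner (e (thead J)) (e (thead J1)) y)%:C%C *: T [tuple of behead J1] y.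

Definition tcl (k : nat) (T : tspin k) : tspin k.+1 :=
  fun J y => g (thead J) *m T [tuple of behead J] y.

Definition tcontract (k : nat) (T : tspin k.+2) : tspin k :=
  fun J y => \sum_(i < n) T [tuple of [:: i, i & J]] y.

Definition tperm (k : nat) (s : {perm 'I_k}) (T : tspin k) : tspin k :=
  fun J => T [tuple tnth J (s r) | r < k].

End Local.

(* Universal expressions: real linear combinations of complete or partial
   contractions built from the metric, the curvature, covariant derivatives and
   Clifford multiplication, acting on spinor-valued k-tensors.  Covariant
   derivatives of the curvature arise from nat_nabla after nat_riem. *)
Inductive natexp (R : realType) : nat -> nat -> Type :=
| nat_id k : natexp R k k
| nat_comp k l p : natexp R l p -> natexp R k l -> natexp R k p
| nat_add k l : natexp R k l -> natexp R k l -> natexp R k l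
| nat_scale k l : R -> natexp R k l -> natexp R k l
| nat_nabla k : natexp R k k.+1
| nat_cl k : natexp R k k.+1
| nat_metric k : natexp R k k.+2
| nat_riem k : natexp R k k.+4
| nat_perm k : {perm 'I_k} -> natexp R k k
| nat_contract k : natexp R k.+2 k.

Fixpoint nateval (R : realType) (n N : nat) (h : 'rV[R]_n -> 'M[R]_n)
    (e : 'I_n -> 'rV[R]_n -> 'rV[R]_n) (g : 'I_n -> 'M[R[i]]_N)
    (k l : nat) (x : natexp R k l) : tspin R n N k -> tspin R n N l :=
  match x in natexp _ k l return tspin R n N k -> tspin R n N l with
  | nat_id k => id
  | nat_comp k l p a b => nateval h e g a \o nateval h e g b
  | nat_add k l a b => fun T J y => nateval h e g a T J y + nateval h e g b T J y
  | nat_scale k l c a => fun T J y => c%:C%C *: nateval h e g a T J y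
  | nat_nabla k => @tnabla R n N h e g k
  | nat_cl k => @tcl R n N g k
  | nat_metric k => @tmetric R n N h e k
  | nat_riem k => @triem R n N h e k
  | nat_perm k s => @tperm R n N k s
  | nat_contract k => @tcontract R n N k
  end.

(* Data of a Riemannian spin manifold; the axioms are in is_spin_manifold.
   The spin structure is given by local trivialisations: over tdom a, a local
   section of the Spin(n)-bundle, its image frame a (an oriented orthonormal
   frame, in components for the chart tchart a), and the transition functions
   spin_trans a b, Spin(n) being realised by its spin representation. *)
Record spin_manifold (R : realType) (n : nat) := SpinManifold {
  carrier : topologicalType;
  chart : Type;
  dom : chart -> set carrier;
  coord : chart -> carrier -> 'rV[R]_n;
  param : chart -> 'rV[R]_n -> carrier;
  gram : chart -> carrier -> 'M[R]_n;
  triv : Type;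
  tdom : triv -> set carrier;
  tchart : triv -> chart;
  frame : triv -> 'I_n -> carrier -> 'rV[R]_n;
  gamma : 'I_n -> 'M[R[i]]_(2 ^ n./2);
  spin_trans : triv -> triv -> carrier -> 'M[R[i]]_(2 ^ n./2) }.

Section SpinManifold.
Variables (R : realType) (n : nat) (S : spin_manifold R n).

Notation M := (carrier S).
Notation fibre := 'cV[R[i]]_(2 ^ n./2).

Definition smooth_on (W : set M) (f : M -> R) : Prop :=
  forall c : chart S, Cinf_on (coord c @` (W `&` dom c)) (f \o param c).

Definition smooth_onC (W : set M) (f : M -> R[i]) : Prop :=
  smooth_on W (fun x => complex.Re (f x)) /\
  smooth_on W (fun x => complex.Im (f x)).

Definition is_manifold : Prop :=
  [/\ hausdorff_space M, @second_countable M,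
      (forall x : M, exists c : chart S, dom c x),
      (forall c : chart S,
        [/\ open (dom c), open (coord c @` dom c),
            (forall x, dom c x -> param c (coord c x) = x),
            {within dom c, continuous (coord c)} &
            {within coord c @` dom c, continuous (param c)}]) &
      (forall (c : chart S) (i : 'I_n), smooth_on (dom c) (fun x => coord c x 0 i))].

(* Differential at x of the change of coordinates from chart c to chart d. *)
Definition change (c d : chart S) (x : M) (v : 'rV[R]_n) : 'rV[R]_n :=
  'D_v (coord d \o param c) (coord c x).

Definition is_metric : Prop :=
  [/\ (forall (c : chart S) (i j : 'I_n),
         smooth_on (dom c) (fun x => gram c x i j)),
      (forall (c : chart S) x, dom c x -> (gram c x)^T = gram c x),
      (forall (c : chart S) x (v : 'rV[R]_n), dom c x -> v != 0 ->
         0 < (v *m gram c x *m v^T) 0 0) &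
      (forall (c d : chart S) x (v w : 'rV[R]_n), dom c x -> dom d x ->
         (v *m gram c x *m w^T) 0 0 =
         (change c d x v *m gram d x *m (change c d x w)^T) 0 0)].

(* A representation of the Clifford algebra with v^2 = - |v|^2 on a space of
   dimension 2^(n/2) is irreducible, i.e. a spinor module. *)
Definition is_clifford : Prop :=
  forall i j : 'I_n, gamma S i *m gamma S j + gamma S j *m gamma S i =
                     ((- 2) * (i == j)%:R)%:M.

Definition cl (v : 'rV[R]_n) : 'M[R[i]]_(2 ^ n./2) :=
  \sum_(i < n) (v 0 i)%:C%C *: gamma S i.

(* Spin(n): products of an even number of unit vectors; the spin
   representation is faithful on it. *)
Definition in_spin (a : 'M[R[i]]_(2 ^ n./2)) : Prop :=
  exists s : seq 'rV[R]_n,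
    [/\ ~~ odd (size s), (forall v, v \in s -> (v *m v^T) 0 0 = 1) &
        a = \big[mulmx/1%:M]_(v <- s) cl v].

Definition is_spin_structure : Prop :=
  [/\ (forall x : M, exists a : triv S, tdom a x),
      (forall a : triv S, open (tdom a) /\ tdom a `<=` dom (tchart a)),
      (forall a : triv S,
        (forall i j, smooth_on (tdom a) (fun x => frame a i x 0 j)) /\
        (forall i j x, tdom a x ->
          (frame a i x *m gram (tchart a) x *m (frame a j x)^T) 0 0
            = (i == j)%:R)) &
      (forall a b : triv S,
        (forall r s, smooth_onC (tdom a `&` tdom b)
                                (fun x => spin_trans a b x r s)) /\
        (forall x, tdom a x -> tdom b x ->
          [/\ in_spin (spin_trans a b x),
              (forall c : triv S, tdom c x ->
                 spin_trans a b x *m spin_trans b c x = spin_trans a c x) &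
              (* the lift of the change of frames A *)
              exists A : 'M[R]_n, forall j,
                spin_trans a b x *m gamma S j =
                  (\sum_(i < n) (A i j)%:C%C *: gamma S i) *m spin_trans a b x
                /\ change (tchart b) (tchart a) x (frame b j x) =
                   \sum_(i < n) A i j *: frame a i x]))].

Definition is_spin_manifold : Prop :=
  [/\ is_manifold, is_metric, is_clifford & is_spin_structure].

(* Spinor fields, by their components in the local trivialisations. *)
Definition spinor_field := triv S -> M -> fibre.

Definition smooth_spinor (psi : spinor_field) : Prop :=
  (forall a r, smooth_onC (tdom a) (fun x => psi a x r 0)) /\
  (forall a b x, tdom a x -> tdom b x -> psi a x = spin_trans a b x *m psi b x).

Definition loc_gram (a : triv S) : 'rV[R]_n -> 'M[R]_n :=
  fun y => gram (tchart a) (param (tchart a) y).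
Definition loc_frame (a : triv S) : 'I_n -> 'rV[R]_n -> 'rV[R]_n :=
  fun i y => frame a i (param (tchart a) y).

Definition L1 (psi : spinor_field) : spinor_field :=
  fun a x => L1_loc (loc_gram a) (loc_frame a) (@gamma _ _ S)
                    (psi a \o param (tchart a)) (coord (tchart a) x).

Definition natexp_op (E : natexp R 0 0) (psi : spinor_field) : spinor_field :=
  fun a x => nateval (loc_gram a) (loc_frame a) (@gamma _ _ S) E
                     (fun _ => psi a \o param (tchart a))
                     [tuple] (coord (tchart a) x).

Definition exp_mul (s : R) (omega : M -> R) (psi : spinor_field) : spinor_field :=
  fun a x => (expR (s * omega x))%:C%C *: psi a x.

Definition eq_spinor (psi phi : spinor_field) : Prop :=
  forall a x, tdom a x -> psi a x = phi a x.

(* The metric exp(2 omega) h with the same spin structure.  The spin frame over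
   e corresponds to the one over exp(- omega) e; as components with respect to
   these frames agree under the fibrewise isometry between the two spinor
   bundles, that identification is the identity of spinor_field. *)
Definition conformal (omega : M -> R) : spin_manifold R n :=
  SpinManifold (@dom _ _ S) (@coord _ _ S) (@param _ _ S)
    (fun c x => expR (2 * omega x) *: gram c x)
    (@tdom _ _ S) (@tchart _ _ S)
    (fun a i x => expR (- omega x) *: frame a i x)
    (@gamma _ _ S) (@spin_trans _ _ S).

End SpinManifold.

(* A family of operators on spinors given, on all Riemannian spin manifolds of
   dimension n, by one and the same universal expression. *)
Definition natural (R : realType) (n : nat)
    (L : forall S : spin_manifold R n, spinor_field S -> spinor_field S) : Prop :=
  exists E : natexp R 0 0, forall S : spin_manifold R n, is_spin_manifold S ->
    forall psi : spinor_field S, smooth_spinor psi ->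
      eq_spinor (L S psi) (natexp_op E psi).

(* Main.v *)
From Pilot Require Import Defs.
From HB Require Import structures.
From mathcomp Require Import all_boot all_order all_algebra.
From mathcomp Require Import all_classical all_reals all_analysis.
From mathcomp Require Import perm complex ring.
Import Pilot.Defs.
Set Implicit Arguments.
Unset Strict Implicit.
Unset Printing Implicit Defensive.
Import Order.TTheory GRing.Theory Num.Theory.
Import numFieldNormedType.Exports.
Local Open Scope classical_set_scope.
Local Open Scope ring_scope.

(* Over the domain of a local trivialisation everything is expressed in the
   orthonormal frame (e_i).  Smooth functions form a ring A with derivations
   d_i, spinors an A-module V with operators d_i and g_i = cl(e_i), and the
   metric only enters through the structure functions c_ijk of the frame,
   [e_i, e_j] = sum_k c_ijk e_k: the Koszul formula gives the connection, hence
   the curvature and D.  The rest is algebra in (A, V, d, g, c).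

   A conformal change replaces d_i by u d_i with u = exp(- w).  With
   G = cl(dw) one finds D' = u (D + (n-1)/2 G), so for m = (n-3)/2
     D'^3 = u^3 (D + (m-1) G) (D + m G) (D + (m+1) G),
   to be compared with exp(- m w) D^3 exp(m w) = (D + m G)^3.  The difference is
   computed from D G + G D = - tr(Hess w) - 2 nabla_(grad w) and from
   [D^2, G], where the identity sum_i cl(e_i) R(e_i, X) = cl(Ric X) / 2 on
   spinors (first Bianchi identity) produces a Ricci term.  It cancels against
   the terms coming from the transformation laws of Ric and scal. *)

(** * Equations in a module *)

(** The coefficients of G are $(m+1, m, m-1)$ in the cube for the new metric and $(m, m, m)$ in the
    conjugated cube. Their middle entries agree, and so do the sums of their outer entries, hence
    all second-order terms cancel and the cubes differ by a first-order operator. Its terms dictate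
    the constants in $L_1$. With $t$ the trace of Hess w: cl(dt) is cancelled by the term $2(n-1)t$
    in the law of scal, which requires $1/(2(n-1))$; $\sum
    \mathrm{Hess}_{ij}\,\mathrm{cl}(e_i)\nabla_j$ is cancelled by the term $(n-2)\mathrm{Hess}$ in
    the law of Ric, which requires $2/(n-2)$; the trace part of Ric then leaves $2t/(n-2)\,D$,
    absorbed by scal D exactly with $1/((n-1)(n-2))$. The terms in scal G cancel because
    $1/((n-1)(n-2)) = 1/(n-2) - 1/(n-1)$. A is not a field, so 1/2, 1/3, 1/(n-1) and 1/(n-2) enter
    as elements with a defining equation. Equality in A has to be equality on the domain, so its
    elements are functions on the domain only, whereas derivatives are taken of functions on all of
    R^n; much of the analytic part mediates between the two. *)

Section ModuleReflection.
Variables (A : comPzRingType) (V : lmodType A).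

Inductive mexp :=
  MVar of nat | MZero | MAdd of mexp & mexp | MOpp of mexp | MScale of A & mexp.

Fixpoint meval (xs : seq V) (e : mexp) : V :=
  match e with
  | MVar k => nth 0 xs k
  | MZero => 0
  | MAdd e1 e2 => meval xs e1 + meval xs e2
  | MOpp e1 => - meval xs e1
  | MScale a e1 => a *: meval xs e1
  end.

(** Atom numbers are compared with [eqn], which [cbn] evaluates on numerals, so that only literal 0
    and 1 reach [ring]. *)
Fixpoint mcoef (k : nat) (e : mexp) : A :=
  match e with
  | MVar j => if eqn k j then 1 else 0
  | MZero => 0
  | MAdd e1 e2 => mcoef k e1 + mcoef k e2
  | MOpp e1 => - mcoef k e1
  | MScale a e1 => a * mcoef k e1
  end.

Let eqnb (k j : nat) : eqn k j = (k == j). Proof. by []. Qed.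

Lemma meval_coef xs e :
  meval xs e = \sum_(k < size xs) mcoef k e *: nth 0 xs k.
Proof.
elim: e => [j||e1 IH1 e2 IH2|e1 IH1|a e1 IH1] /=.
- have [ltj|gej] := ltnP j (size xs).
    rewrite (bigD1 (Ordinal ltj)) //= eqnb eqxx scale1r big1 ?addr0 // => k.
    by rewrite eqnb -val_eqE /= => /negPf ->; rewrite scale0r.
  rewrite nth_default // big1 // => k _; rewrite eqnb.
  by rewrite ltn_eqF ?scale0r // (leq_trans (ltn_ord k)).
- by rewrite big1 // => k _; rewrite scale0r.
- by rewrite IH1 IH2 -big_split; apply: eq_bigr => k _; rewrite scalerDl.
- by rewrite IH1 -sumrN; apply: eq_bigr => k _; rewrite scaleNr.
- by rewrite IH1 scaler_sumr; apply: eq_bigr => k _; rewrite scalerA.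
Qed.

Fixpoint mcoefs_eq (k : nat) (e1 e2 : mexp) : Prop :=
  if k is k'.+1 then mcoef k' e1 = mcoef k' e2 /\ mcoefs_eq k' e1 e2 else True.

Lemma meval_eq xs e1 e2 :
  mcoefs_eq (size xs) e1 e2 -> meval xs e1 = meval xs e2.
Proof.
have coefP m k : mcoefs_eq m e1 e2 -> (k < m)%N -> mcoef k e1 = mcoef k e2.
  elim: m => // m IH /= [em /IH{}IH]; rewrite ltnS leq_eqVlt.
  by case/predU1P => [-> //|].
move=> eq12; rewrite !meval_coef; apply: eq_bigr => k _.
by rewrite (coefP _ _ eq12).
Qed.

End ModuleReflection.

(** The inner [match] runs the tactic [unify] while a term is being computed; its failure sends the
    outer [match] to the next branch. Atoms are thus identified up to unification, not only
    syntactically. *)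
Ltac mod_mem x xs :=
  match xs with
  | @nil _ => constr:(false)
  | cons ?y ?ys =>
    match constr:(Set) with
    | _ => let _ := match constr:(Set) with _ => unify x y end in constr:(true)
    | _ => mod_mem x ys
    end
  end.
Ltac mod_atoms t xs :=
  lazymatch t with
  | GRing.zero => xs
  | GRing.add ?x ?y => let xs := mod_atoms x xs in mod_atoms y xs
  | GRing.opp ?x => mod_atoms x xs
  | GRing.scale ?a ?x => mod_atoms x xs
  | _ => lazymatch mod_mem t xs with
         | true => xs
         | false => constr:(cons t xs)
         end
  end.
Ltac mod_index x xs :=
  match xs with
  | cons ?y ?ys =>
    match constr:(Set) with
    | _ => let _ := match constr:(Set) with _ => unify x y end in constr:(O)
    | _ => let k := mod_index x ys in constr:(S k)
    end
  end.
Ltac mod_reify A t xs :=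
  lazymatch t with
  | GRing.zero => constr:(@MZero A)
  | GRing.add ?x ?y =>
    let x := mod_reify A x xs in let y := mod_reify A y xs in
    constr:(@MAdd A x y)
  | GRing.opp ?x => let x := mod_reify A x xs in constr:(@MOpp A x)
  | GRing.scale ?a ?x => let x := mod_reify A x xs in constr:(@MScale A a x)
  | _ => let k := mod_index t xs in constr:(@MVar A k)
  end.
Ltac mod_split :=
  lazymatch goal with
  | |- _ /\ _ => split; [ | mod_split]
  | |- True => exact I
  end.
(* Reduces an equation in a module over A to the equations in A between the
   coefficients of its atoms. *)
Ltac module_coefs A V :=
  lazymatch goal with
  | |- ?x = ?y =>
    let xs := mod_atoms x (@nil V) in
    let xs := mod_atoms y xs in
    let ex := mod_reify A x xs in
    let ey := mod_reify A y xs in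
    refine (@meval_eq A V xs ex ey _);
    cbn [mcoefs_eq mcoef size eqn]; mod_split
  end.

(** * Calculus in an orthonormal frame *)

Section Sums.
Variables (A : comPzRingType) (V : lmodType A) (n : nat).

Lemma sum_delta (f : 'I_n -> A) j : \sum_i (i == j)%:R * f i = f j.
Proof.
rewrite (bigD1 j) //= eqxx mul1r big1 ?addr0 // => i /negPf ->.
by rewrite mul0r.
Qed.

Lemma sum_deltaZ (f : 'I_n -> V) j : \sum_i (i == j)%:R *: f i = f j.
Proof.
rewrite (bigD1 j) //= eqxx scale1r big1 ?addr0 // => i /negPf ->.
by rewrite scale0r.
Qed.

Lemma sum3_rot (F : 'I_n -> 'I_n -> 'I_n -> V) :
  \sum_i \sum_j \sum_k F i j k = \sum_i \sum_j \sum_k F k i j.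
Proof.
under [RHS]eq_bigr do rewrite exchange_big.
by rewrite [RHS]exchange_big.
Qed.

End Sums.

(* A: smooth functions, V: spinors, d and dV: differentiation along the frame,
   c: its structure functions.  fa_inj, the independence of the d_i, is what
   determines c, and gives its antisymmetry and the Jacobi identity. *)
Record frame_axioms (A : comPzRingType) (V : lmodType A) (n : nat)
    (d : 'I_n -> A -> A) (dV : 'I_n -> V -> V) (g : 'I_n -> V -> V)
    (c : 'I_n -> 'I_n -> 'I_n -> A) : Prop := FrameAxioms {
  fa_dD : forall i a b, d i (a + b) = d i a + d i b;
  fa_dM : forall i a b, d i (a * b) = d i a * b + a * d i b;
  fa_dVD : forall i v w, dV i (v + w) = dV i v + dV i w;
  fa_dVZ : forall i a v, dV i (a *: v) = d i a *: v + a *: dV i v;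
  fa_comm : forall i j a,
    d i (d j a) - d j (d i a) = \sum_p c i j p * d p a;
  fa_commV : forall i j v,
    dV i (dV j v) - dV j (dV i v) = \sum_p c i j p *: dV p v;
  fa_inj : forall x : 'I_n -> A,
    (forall a, \sum_p x p * d p a = 0) -> forall p, x p = 0;
  fa_gD : forall i v w, g i (v + w) = g i v + g i w;
  fa_gZ : forall i a v, g i (a *: v) = a *: g i v;
  fa_dVg : forall i j v, dV i (g j v) = g j (dV i v);
  fa_clifford : forall i j v,
    g i (g j v) + g j (g i v) = (- (2 * (i == j)%:R)) *: v }.

Section FrameDefs.
Variables (A : comPzRingType) (V : lmodType A) (n : nat).
Variables (d : 'I_n -> A -> A) (dV : 'I_n -> V -> V) (g : 'I_n -> V -> V).
Variable (c : 'I_n -> 'I_n -> 'I_n -> A).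
(* To be thought of as 1 / 2, 1 / (n - 1) and 1 / (n - 2). *)
Variables (h q1 q2 : A).

(* Koszul formula: the component of nabla_(e_i) e_j along e_k. *)
Definition christoffel i j k := h * (c i j k - c j k i + c k i j).

(** Action on spinors of an antisymmetric matrix under the isomorphism of so(n) with the Lie algebra
    of Spin(n); [h * h] is its factor 1/4. *)
Definition quad (M : 'I_n -> 'I_n -> A) (v : V) : V :=
  (h * h) *: \sum_a \sum_b M a b *: g a (g b v).

Definition nab i v := dV i v + quad (christoffel i) v.

Definition dir v := \sum_i g i (nab i v).

Definition clm (x : 'I_n -> A) v := \sum_i x i *: g i v.

(** Component along $e_l$ of $R(e_i, e_j) e_k$; the last term is the $\nabla_{[e_i, e_j]}$ of a
    non-coordinate frame. *)
Definition curv i j k l :=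
  d i (christoffel j k l) - d j (christoffel i k l)
  + \sum_p (christoffel j k p * christoffel i p l - christoffel i k p * christoffel j p l
            - c i j p * christoffel p k l).

Definition ricci j k := \sum_i curv i j k i.

Definition scalar := \sum_k ricci k k.

Definition clric v := \sum_i \sum_j ricci i j *: g i (nab j v).

Definition L1a v :=
  dir (dir (dir v)) - (h * q1) *: clm (fun i => d i scalar) v
  - (2 * q2) *: clric v + (scalar * (q1 * q2)) *: dir v.

End FrameDefs.

Section FrameTheory.
Variables (A : comPzRingType) (V : lmodType A) (n : nat).
Variables (d : 'I_n -> A -> A) (dV : 'I_n -> V -> V) (g : 'I_n -> V -> V).
Variable (c : 'I_n -> 'I_n -> 'I_n -> A).
Hypothesis fa : frame_axioms d dV g c.
Variable (h : A).
Hypothesis h2 : 2 * h = 1.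

Let dD := fa_dD fa. Let dM := fa_dM fa. Let dVD := fa_dVD fa.
Let dVZ := fa_dVZ fa. Let gD := fa_gD fa. Let gZ := fa_gZ fa.

Local Notation Gam := (christoffel c h).
Local Notation Rm := (curv d c h).
Local Notation Rc := (ricci d c h).
Local Notation Nab := (nab dV g c h).
Local Notation Quad := (quad g h).
Local Notation Dir := (dir dV g c h).

Lemma frame_d0 i : d i 0 = 0.
Proof. by apply: (addrI (d i 0)); rewrite -dD !addr0. Qed.

Lemma frame_dN i a : d i (- a) = - d i a.
Proof. by apply: (addrI (d i a)); rewrite -dD !subrr frame_d0. Qed.

Lemma frame_dB i a b : d i (a - b) = d i a - d i b.
Proof. by rewrite dD frame_dN. Qed.

Lemma frame_dS i (I : Type) (r : seq I) (P : pred I) (f : I -> A) :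
  d i (\sum_(k <- r | P k) f k) = \sum_(k <- r | P k) d i (f k).
Proof. exact: (big_morph (d i) (dD i) (frame_d0 i)). Qed.

Lemma frame_d1 i : d i 1 = 0.
Proof.
by have := dM i 1 1; rewrite !mulr1 mul1r -{1}[d i 1]addr0 => /addrI.
Qed.

Lemma frame_dnat i k : d i k%:R = 0.
Proof.
by elim: k => [|k IH]; rewrite ?frame_d0 // -addn1 natrD dD IH frame_d1 addr0.
Qed.

(** Constancy of [h], [q1], [q2] is not assumed: a derivation kills the inverse of an integer
    because it kills 1 and the integer. *)
Lemma frame_dinv i k a : k%:R * a = 1 -> d i a = 0.
Proof.
move=> ka; have : d i (k%:R * a) = 0 by rewrite ka frame_d1.
rewrite dM frame_dnat mul0r add0r => kda.
by rewrite -[d i a]mul1r -ka mulrAC kda mul0r.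
Qed.

Lemma frame_dV0 i : dV i 0 = 0.
Proof. by apply: (addrI (dV i 0)); rewrite -dVD !addr0. Qed.

Lemma frame_dVS i (I : Type) (r : seq I) (P : pred I) (f : I -> V) :
  dV i (\sum_(k <- r | P k) f k) = \sum_(k <- r | P k) dV i (f k).
Proof. exact: (big_morph (dV i) (dVD i) (frame_dV0 i)). Qed.

Lemma frame_g0 i : g i 0 = 0.
Proof. by apply: (addrI (g i 0)); rewrite -gD !addr0. Qed.

Lemma frame_gN i v : g i (- v) = - g i v.
Proof. by rewrite -scaleN1r gZ scaleN1r. Qed.

Lemma frame_gB i v w : g i (v - w) = g i v - g i w.
Proof. by rewrite gD frame_gN. Qed.

Lemma frame_gS i (I : Type) (r : seq I) (P : pred I) (f : I -> V) :
  g i (\sum_(k <- r | P k) f k) = \sum_(k <- r | P k) g i (f k).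
Proof. exact: (big_morph (g i) (gD i) (frame_g0 i)). Qed.

Lemma frame_gC i j v :
  g i (g j v) = - g j (g i v) - (2 * (i == j)%:R) *: v.
Proof.
by apply: (addIr (g j (g i v))); rewrite (fa_clifford fa) addrAC addNr add0r scaleNr.
Qed.

(** * Structure functions, Christoffel symbols and the symmetries of the curvature *)

Lemma bracket_antisym i j k : c i j k = - c j i k.
Proof.
apply/eqP; rewrite -subr_eq0 opprK; apply/eqP.
apply: (fa_inj fa (x := fun k => c i j k + c j i k)) => a.
under eq_bigr do rewrite mulrDl.
by rewrite big_split /= -!(fa_comm fa) addrC subrKA subrr.
Qed.

Lemma christoffel_antisym i j k : Gam i j k = - Gam i k j.
Proof.
rewrite /christoffel (bracket_antisym k i) (bracket_antisym j k) (bracket_antisym i j).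
by ring.
Qed.

Lemma christoffel_torsion i j k : Gam i j k - Gam j i k = c i j k.
Proof.
rewrite -[RHS]mul1r -h2 /christoffel.
rewrite (bracket_antisym j i) (bracket_antisym i k) (bracket_antisym k j).
by ring.
Qed.

(** Paired with $d_l a$ and summed over l, one cyclic term is the double commutator $[d_i,
    [d_j, d_k]] a$ ([J'E]). The three double commutators cancel, and [fa_inj] strips off the
    derivations. *)
Lemma jacobi i j k l :
  let J i j k := d i (c j k l) + \sum_p c j k p * c i p l in
  J i j k + J j k i + J k i j = 0.
Proof.
move=> J.
pose J' i j k l := d i (c j k l) + \sum_p c j k p * c i p l.
have J'E i' j' k' a : \sum_l J' i' j' k' l * d l a =
    d i' (d j' (d k' a)) - d i' (d k' (d j' a))
    - d j' (d k' (d i' a)) + d k' (d j' (d i' a)).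
  under eq_bigr do rewrite mulrDl mulr_suml.
  rewrite big_split /= exchange_big /=.
  under [X in _ + X]eq_bigr do [under eq_bigr do rewrite -mulrA; rewrite -mulr_sumr].
  under [X in _ + X]eq_bigr do rewrite -(fa_comm fa) mulrBr.
  rewrite sumrB -(fa_comm fa j' k' (d i' a)).
  have dc : d i' (d j' (d k' a)) - d i' (d k' (d j' a)) =
      \sum_p d i' (c j' k' p) * d p a + \sum_p c j' k' p * d i' (d p a).
    by rewrite -frame_dB (fa_comm fa) frame_dS -big_split; apply: eq_bigr.
  rewrite dc; ring.
apply: (fa_inj fa (x := fun l => J' i j k l + J' j k i l + J' k i j l)) => a.
under eq_bigr do rewrite 2!mulrDl.
by rewrite 2!big_split /= !J'E; ring.
Qed.

Lemma curv_antisym12 i j k l : Rm i j k l = - Rm j i k l.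
Proof.
rewrite /curv opprD opprB -sumrN; congr (_ + _); apply: eq_bigr => p _.
rewrite (bracket_antisym j i); ring.
Qed.

Lemma curv_antisym34 i j k l : Rm i j k l = - Rm i j l k.
Proof.
rewrite /curv (christoffel_antisym j k l) (christoffel_antisym i k l) !frame_dN !opprD -sumrN.
congr (_ + _); apply: eq_bigr => p _.
rewrite (christoffel_antisym i p l) (christoffel_antisym j p l) (christoffel_antisym p k l).
rewrite (christoffel_antisym i p k) (christoffel_antisym j p k); ring.
Qed.

(** This is the Jacobi identity after each structure function is replaced by a difference of
    Christoffel symbols (torsion freeness). *)
Lemma bianchi i j k l : Rm i j k l + Rm j k i l + Rm k i j l = 0.
Proof.
rewrite -[RHS](jacobi i j k l) /curv -!christoffel_torsion !frame_dB.
rewrite [RHS](_ : _ = d i (Gam j k l) - d i (Gam k j l)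
  + (d j (Gam k i l) - d j (Gam i k l)) + (d k (Gam i j l) - d k (Gam j i l))
  + (\sum_p c j k p * c i p l + \sum_p c k i p * c j p l
     + \sum_p c i j p * c k p l)); last by ring.
rewrite -!big_split /= [RHS](_ : _ = d i (Gam j k l) - d i (Gam k j l)
  + (d j (Gam k i l) - d j (Gam i k l)) + (d k (Gam i j l) - d k (Gam j i l))
  + \sum_p (Gam j k p * Gam i p l - Gam i k p * Gam j p l
            - c i j p * Gam p k l + 
            (Gam k i p * Gam j p l - Gam j i p * Gam k p l
            - c j k p * Gam p i l) +
            (Gam i j p * Gam k p l - Gam k j p * Gam i p l
            - c k i p * Gam p j l))).
  rewrite !big_split /=; ring.
congr (_ + _); apply: eq_bigr => p _; rewrite -!christoffel_torsion; ring.
Qed.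

(** The octahedron argument: in this signed sum of four Bianchi identities the antisymmetries leave
    twice the wanted difference, and [h] divides by 2. *)
Lemma curv_pair i j k l : Rm i j k l = Rm k l i j.
Proof.
have B1 := bianchi i j k l; have B2 := bianchi j k l i.
have B3 := bianchi k l i j; have B4 := bianchi l i j k.
apply/eqP; rewrite -subr_eq0; apply/eqP.
rewrite -[LHS]mul1r -h2.
transitivity (h * ((Rm i j k l + Rm j k i l + Rm k i j l)
  - (Rm k l i j + Rm l i k j + Rm i k l j)
  + (Rm j k l i + Rm k l j i + Rm l j k i)
  - (Rm l i j k + Rm i j l k + Rm j l i k))).
  rewrite (curv_antisym34 i j l k) (curv_antisym34 k l j i) (curv_antisym34 i k l j).
  rewrite (curv_antisym34 l i j k) (curv_antisym34 j k l i) (curv_antisym12 k i j l).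
  rewrite (curv_antisym12 l j k i) (curv_antisym34 j l k i); ring.
by rewrite B1 B2 B3 B4; ring.
Qed.

(** Pair symmetry moves the cycle to the first, third and fourth slots, the ones that carry Clifford
    generators in [ricci_spin]. *)
Lemma bianchi' i j k l : Rm i j k l + Rm k j l i + Rm l j i k = 0.
Proof.
rewrite -[RHS](bianchi i k l j) (curv_pair i j k l) (curv_pair k j l i).
by rewrite (curv_pair l j i k); ring.
Qed.

Lemma ricci_sym j k : Rc j k = Rc k j.
Proof.
apply: eq_bigr => i _.
by rewrite curv_pair curv_antisym12 curv_antisym34 opprK.
Qed.


(** * The spin connection and its curvature *)

Lemma quadD M v w : Quad M (v + w) = Quad M v + Quad M w.
Proof.
rewrite /quad -scalerDr -big_split; congr (_ *: _); apply: eq_bigr => a _.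
by rewrite -big_split; apply: eq_bigr => b _; rewrite !gD scalerDr.
Qed.

Lemma quadZ M a v : Quad M (a *: v) = a *: Quad M v.
Proof.
rewrite /quad [RHS]scalerA [a * _]mulrC -[RHS]scalerA; congr (_ *: _).
rewrite scaler_sumr; apply: eq_bigr => i _.
by rewrite scaler_sumr; apply: eq_bigr => j _; rewrite !gZ !scalerA mulrC.
Qed.

Lemma quad0 M : Quad M 0 = 0.
Proof. by apply: (addrI (Quad M 0)); rewrite -quadD !addr0. Qed.

Lemma quadS M (I : Type) (r : seq I) (P : pred I) (f : I -> V) :
  Quad M (\sum_(k <- r | P k) f k) = \sum_(k <- r | P k) Quad M (f k).
Proof. exact: (big_morph (Quad M) (quadD M) (quad0 M)). Qed.

Lemma quad_add M N v :
  Quad (fun a b => M a b + N a b) v = Quad M v + Quad N v.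
Proof.
rewrite /quad -scalerDr -big_split; congr (_ *: _); apply: eq_bigr => a _.
by rewrite -big_split; apply: eq_bigr => b _; rewrite scalerDl.
Qed.

Lemma quad_scale x M v : Quad (fun a b => x * M a b) v = x *: Quad M v.
Proof.
rewrite /quad [RHS]scalerA [x * _]mulrC -[RHS]scalerA; congr (_ *: _).
rewrite scaler_sumr; apply: eq_bigr => i _.
by rewrite scaler_sumr; apply: eq_bigr => j _; rewrite scalerA.
Qed.

Lemma eq_quad M N v : (forall a b, M a b = N a b) -> Quad M v = Quad N v.
Proof.
move=> MN; congr (_ *: _); apply: eq_bigr => a _; apply: eq_bigr => b _.
by rewrite MN.
Qed.

Lemma quad_sum (M : 'I_n -> 'I_n -> 'I_n -> A) v :
  Quad (fun a b => \sum_p M p a b) v = \sum_p Quad (M p) v.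
Proof.
rewrite /quad -scaler_sumr [in RHS]exchange_big; congr (_ *: _).
apply: eq_bigr => a _; rewrite [RHS]exchange_big; apply: eq_bigr => b _.
by rewrite scaler_suml.
Qed.

(** The commutator with [Quad M] acts on vectors as M, which makes the spin connection compatible
    with Clifford multiplication. Moving $g_j$ across $g_a g_b$ gives two contractions with factor
    2, equal by antisymmetry; together they cancel the 1/4. *)
Lemma quad_g M j v : (forall a b, M a b = - M b a) ->
  Quad M (g j v) = g j (Quad M v) + \sum_k M j k *: g k v.
Proof.
move=> Masym.
have gggC a b : g a (g b (g j v)) =
    g j (g a (g b v)) + 2 *: ((a == j)%:R *: g b v) - 2 *: ((b == j)%:R *: g a v).
  rewrite (frame_gC b j) frame_gB frame_gN !gZ (frame_gC a j).
  by module_coefs A V; ring.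
rewrite /quad gZ frame_gS.
under eq_bigr => a _ do under eq_bigr => b _ do
  rewrite gggC scalerDr scalerDr scalerN.
under eq_bigr do rewrite !big_split /= sumrN.
rewrite !big_split /= sumrN.
have -> : \sum_a \sum_b M a b *: (2 *: ((a == j)%:R *: g b v)) =
    2 *: \sum_k M j k *: g k v.
  rewrite exchange_big scaler_sumr; apply: eq_bigr => b _ /=.
  rewrite -[M j b](sum_delta (fun a => M a b)) scaler_suml scaler_sumr.
  by apply: eq_bigr => a _; rewrite !scalerA; congr (_ *: _); ring.
have -> : \sum_a \sum_b M a b *: (2 *: ((b == j)%:R *: g a v)) =
    - (2 *: \sum_k M j k *: g k v).
  rewrite scaler_sumr -sumrN; apply: eq_bigr => a _ /=.
  rewrite -(sum_delta (fun b => M b a)) scaler_suml scaler_sumr -sumrN.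
  apply: eq_bigr => b _; rewrite Masym !scalerA -scaleNr; congr (_ *: _); ring.
have -> : \sum_i g j (\sum_b M i b *: g i (g b v)) =
    \sum_i \sum_b M i b *: g j (g i (g b v)).
  by apply: eq_bigr => a _; rewrite frame_gS; apply: eq_bigr => b _; rewrite gZ.
module_coefs A V; [ring|].
by transitivity ((2 * h) * (2 * h)); [ring|rewrite h2 mulr1; ring].
Qed.

(** [quad] respects commutators: [Quad L] is moved past both generators of each $g_a g_b$ in
    [Quad M], and [quad_g] supplies the two product sums. *)
Lemma quad_comm L M v :
  (forall a b, L a b = - L b a) -> Quad L (Quad M v) =
  Quad M (Quad L v)
  + Quad (fun a b => \sum_p (M a p * L p b - L a p * M p b)) v.
Proof.
move=> Lasym.
have QM w : Quad M w = (h * h) *: \sum_a \sum_b M a b *: g a (g b w) by [].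
rewrite [Quad M v]QM quadZ quadS QM -scalerDr; congr (_ *: _).
under eq_bigr => a _.
  rewrite quadS.
  under eq_bigr => b _.
    rewrite quadZ (quad_g _ _ Lasym) (quad_g _ _ Lasym) gD frame_gS !scalerDr.
    over.
  rewrite !big_split /=.
  over.
rewrite !big_split /= -addrA; congr (_ + _).
under [RHS]eq_bigr do under eq_bigr do rewrite sumrB scalerBl !scaler_suml.
under [RHS]eq_bigr do rewrite sumrB.
rewrite sumrB; congr (_ + _).
  apply: eq_bigr => a _; rewrite [RHS]exchange_big; apply: eq_bigr => b _ /=.
  rewrite scaler_sumr; apply: eq_bigr => k _.
  by rewrite gZ scalerA.
rewrite exchange_big /= -sumrN.
transitivity (\sum_b \sum_a \sum_k (M a b * L a k) *: g k (g b v)).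
  apply: eq_bigr => b _; apply: eq_bigr => a _.
  by rewrite scaler_sumr; apply: eq_bigr => k _; rewrite scalerA.
under eq_bigr do rewrite exchange_big /=.
rewrite exchange_big /=; apply: eq_bigr => k _; rewrite -sumrN.
apply: eq_bigr => b _; rewrite -sumrN; apply: eq_bigr => a _.
by rewrite [L k a]Lasym mulNr scaleNr opprK mulrC.
Qed.

Lemma nabD i v w : Nab i (v + w) = Nab i v + Nab i w.
Proof. by rewrite /nab dVD quadD addrACA. Qed.

Lemma nabZ i a v : Nab i (a *: v) = d i a *: v + a *: Nab i v.
Proof. by rewrite /nab dVZ quadZ scalerDr addrA. Qed.

Lemma nab0 i : Nab i 0 = 0.
Proof. by apply: (addrI (Nab i 0)); rewrite -nabD !addr0. Qed.

Lemma nabS i (I : Type) (r : seq I) (P : pred I) (f : I -> V) :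
  Nab i (\sum_(k <- r | P k) f k) = \sum_(k <- r | P k) Nab i (f k).
Proof. exact: (big_morph (Nab i) (nabD i) (nab0 i)). Qed.

Lemma nab_g i j v :
  Nab i (g j v) = g j (Nab i v) + \sum_k Gam i j k *: g k v.
Proof.
by rewrite /nab (fa_dVg fa) (quad_g _ _ (christoffel_antisym i)) gD addrA.
Qed.

Lemma dV_quad i M v :
  dV i (Quad M v) = Quad (fun a b => d i (M a b)) v + Quad M (dV i v).
Proof.
have dh : d i (h * h) = 0.
  by rewrite dM (frame_dinv i h2) mul0r mulr0 addr0.
rewrite /quad dVZ dh scale0r add0r -scalerDr; congr (_ *: _).
rewrite frame_dVS -big_split; apply: eq_bigr => a _.
rewrite frame_dVS -big_split; apply: eq_bigr => b _.
by rewrite dVZ !(fa_dVg fa).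
Qed.

(** The curvature of the spin connection is the spin image of the Riemann curvature. The products of
    Christoffel symbols come from [quad_comm], the derivatives from [dV_quad], and the structure
    functions restore [Nab] along the bracket. *)
Lemma nab_comm i j v :
  Nab i (Nab j v) - Nab j (Nab i v) =
  \sum_p c i j p *: Nab p v + Quad (Rm i j) v.
Proof.
pose dG i j a b := d i (Gam j a b).
pose P i j a b := \sum_p (Gam j a p * Gam i p b - Gam i a p * Gam j p b).
have RmE : Quad (Rm i j) v = Quad (dG i j) v - Quad (dG j i) v
    + Quad (P i j) v - \sum_p c i j p *: Quad (Gam p) v.
  transitivity (Quad (fun a b => dG i j a b + -1 * dG j i a b + P i j a b
      + -1 * \sum_p c i j p * Gam p a b) v).
    by apply: eq_quad => a b; rewrite /curv /P /dG sumrB; ring.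
  rewrite !quad_add !quad_scale !scaleN1r
    (quad_sum (fun p a b => c i j p * Gam p a b)); congr (_ - _).
  by apply: eq_bigr => p _; rewrite quad_scale.
have -> : \sum_p c i j p *: Nab p v =
    \sum_p c i j p *: dV p v + \sum_p c i j p *: Quad (Gam p) v.
  by rewrite -big_split; apply: eq_bigr => p _; rewrite scalerDr.
rewrite RmE -(fa_commV fa).
rewrite /nab !dVD !dV_quad !quadD.
rewrite (quad_comm (Gam j) v (christoffel_antisym i)) -/(P i j) -/(dG i j) -/(dG j i).
by module_coefs A V; ring.
Qed.

Variable (h3 : A).
Hypothesis h3E : 3 * h3 = 1.

Lemma self_opp0 (x : A) : x = - x -> x = 0.
Proof. by move=> xN; rewrite -[x]mul1r -h2 mulrAC mulr2n mulrDl mul1r {1}xN addNr mul0r. Qed.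

Lemma curv_trace_ij j v :
  \sum_i \sum_k \sum_l (Rm i j k l * (i == l)%:R) *: g k v =
  \sum_k Rc j k *: g k v.
Proof.
rewrite exchange_big /=; apply: eq_bigr => k _; rewrite scaler_suml.
apply: eq_bigr => i _; rewrite -scaler_suml; congr (_ *: _).
rewrite -[RHS](sum_delta (fun l => Rm i j k l)).
by apply: eq_bigr => l _; rewrite mulrC eq_sym.
Qed.

Lemma curv_trace_ik j v :
  \sum_i \sum_k \sum_l (Rm i j k l * (i == k)%:R) *: g l v =
  - \sum_k Rc j k *: g k v.
Proof.
rewrite -curv_trace_ij -sumrN; apply: eq_bigr => i _.
rewrite exchange_big /= -sumrN; apply: eq_bigr => k _.
rewrite -sumrN; apply: eq_bigr => l _.
by rewrite curv_antisym34 mulNr scaleNr.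
Qed.

(* Cyclic permutations of g_i g_k g_l only differ by contractions, and the sum
   over the three of them vanishes by the Bianchi identity. *)
Lemma ricci_spin j v :
  \sum_i g i (Quad (Rm i j) v) = h *: \sum_k Rc j k *: g k v.
Proof.
pose rho := \sum_k Rc j k *: g k v; rewrite -/rho.
pose T := \sum_i \sum_k \sum_l Rm i j k l *: g i (g k (g l v)).
have gcyc1 i k l : g k (g l (g i v)) = g i (g k (g l v))
    + (2 * (i == k)%:R) *: g l v - (2 * (i == l)%:R) *: g k v.
  rewrite (frame_gC l i) frame_gB frame_gN gZ (frame_gC k i) (eq_sym l) (eq_sym k).
  by module_coefs A V; ring.
have gcyc2 i k l : g l (g i (g k v)) = g i (g k (g l v))
    + (2 * (k == l)%:R) *: g i v - (2 * (i == l)%:R) *: g k v.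
  rewrite (frame_gC l i) (frame_gC l k) frame_gB frame_gN gZ.
  by rewrite (eq_sym l i) (eq_sym l k); module_coefs A V; ring.
have T1 : \sum_i \sum_k \sum_l Rm i j k l *: g k (g l (g i v)) = T - 4 *: rho.
  transitivity (T + 2 *: \sum_i \sum_k \sum_l (Rm i j k l * (i == k)%:R) *: g l v
    - 2 *: \sum_i \sum_k \sum_l (Rm i j k l * (i == l)%:R) *: g k v).
    rewrite /T !scaler_sumr -sumrN -!big_split /=; apply: eq_bigr => i _.
    rewrite !scaler_sumr -sumrN -!big_split /=; apply: eq_bigr => k _.
    rewrite !scaler_sumr -sumrN -!big_split /=; apply: eq_bigr => l _.
    by rewrite gcyc1; module_coefs A V; ring.
  by rewrite curv_trace_ij curv_trace_ik -/rho; module_coefs A V; ring.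
have T2 : \sum_i \sum_k \sum_l Rm i j k l *: g l (g i (g k v)) = T - 2 *: rho.
  transitivity (T + 2 *: \sum_i \sum_k \sum_l (Rm i j k l * (k == l)%:R) *: g i v
    - 2 *: \sum_i \sum_k \sum_l (Rm i j k l * (i == l)%:R) *: g k v).
    rewrite /T !scaler_sumr -sumrN -!big_split /=; apply: eq_bigr => i _.
    rewrite !scaler_sumr -sumrN -!big_split /=; apply: eq_bigr => k _.
    rewrite !scaler_sumr -sumrN -!big_split /=; apply: eq_bigr => l _.
    by rewrite gcyc2; module_coefs A V; ring.
  rewrite curv_trace_ij [X in T + 2 *: X]big1 ?scaler0 ?addr0 // => i _.
  rewrite big1 // => k _; rewrite big1 // => l _.
  have [->|_] := eqVneq k l; last by rewrite mulr0 scale0r.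
  by rewrite mulr1 (self_opp0 (curv_antisym34 i j l l)) scale0r.
have T0 : T + (T - 4 *: rho) + (T - 2 *: rho) = 0.
  (* Relabelling the summation indices moves the cyclic permutation from the Clifford product to the
     curvature, where [bianchi'] applies. *)
  have E1 : T - 4 *: rho = \sum_i \sum_k \sum_l Rm l j i k *: g i (g k (g l v)).
    by rewrite -T1 [LHS]sum3_rot.
  have E2 : T - 2 *: rho = \sum_i \sum_k \sum_l Rm k j l i *: g i (g k (g l v)).
    by rewrite -T2 [LHS]sum3_rot [LHS]sum3_rot.
  rewrite E1 E2 /T -!big_split big1 // => i _.
  rewrite -!big_split big1 // => k _; rewrite -!big_split big1 // => l _ /=.
  by rewrite -!scalerDl addrAC bianchi' scale0r.
have T3 : T = 2 *: rho.
  (* [T0] says $3T = 6\rho$; dividing by 3 is what [h3] is for. *)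
  have -> : T = 2 *: rho + h3 *: (T + (T - 4 *: rho) + (T - 2 *: rho)).
    have E3 : 2 * (1 - 3 * h3) = 0 by rewrite h3E subrr mulr0.
    module_coefs A V; [by rewrite -[LHS]h3E; ring | by rewrite -[LHS]E3; ring].
  by rewrite T0 scaler0 addr0.
transitivity ((h * h) *: T); last first.
  by rewrite T3 scalerA -mulrA [h * 2]mulrC h2 mulr1.
rewrite /T scaler_sumr; apply: eq_bigr => i _.
rewrite gZ frame_gS; congr (_ *: _); apply: eq_bigr => k _.
by rewrite frame_gS; apply: eq_bigr => l _; rewrite gZ.
Qed.

Lemma half_eq (v x : V) : v = x - v -> v = h *: x.
Proof.
move=> vx; have -> : v = h *: (v + v).
  by rewrite -[LHS]scale1r -h2; module_coefs A V; ring.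
by rewrite {1}vx subrK.
Qed.

(** Averaging with the sum in which i and j are exchanged replaces $g_i g_j$ by half its
    anticommutator, $-\delta_{ij}$. *)
Lemma clifford_sym (S : 'I_n -> 'I_n -> A) v : (forall i j, S i j = S j i) ->
  \sum_i \sum_j S i j *: g i (g j v) = - ((\sum_i S i i) *: v).
Proof.
move=> Ssym; rewrite -scaleNr -[in RHS](mul1r (\sum_i S i i)) -h2 -mulNr.
rewrite (_ : - (2 * h) * _ = h * ((- 2) * \sum_i S i i)); last by ring.
rewrite -scalerA; apply: half_eq; apply/eqP; rewrite -subr_eq0 opprB addrA subr_eq0.
apply/eqP; rewrite {1}exchange_big -big_split mulr_sumr scaler_suml.
apply: eq_bigr => j _; rewrite -big_split.
rewrite -[S j j](sum_delta (fun i => S i j)) mulr_sumr scaler_suml.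
apply: eq_bigr => i _ /=.
rewrite [S j i]Ssym -scalerDr (fa_clifford fa) scalerA; congr (_ *: _); ring.
Qed.

Lemma dirD v x : Dir (v + x) = Dir v + Dir x.
Proof. by rewrite -big_split; apply: eq_bigr => i _; rewrite nabD gD. Qed.

Lemma dirZ a v : Dir (a *: v) = a *: Dir v + clm g (fun i => d i a) v.
Proof.
rewrite scaler_sumr -big_split; apply: eq_bigr => i _ /=.
by rewrite nabZ gD !gZ addrC.
Qed.

Lemma dir_const a v : (forall i, d i a = 0) -> Dir (a *: v) = a *: Dir v.
Proof.
by move=> da; rewrite dirZ /clm big1 ?addr0 // => i _; rewrite da scale0r.
Qed.

Lemma dirN v : Dir (- v) = - Dir v.
Proof.
rewrite -scaleN1r dir_const ?scaleN1r // => i.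
by rewrite frame_dN frame_d1 oppr0.
Qed.

(** * Clifford multiplication by a closed one-form *)

Variable w : 'I_n -> A.
Hypothesis w_closed :
  forall i j, d i (w j) - d j (w i) = \sum_p c i j p * w p.

Local Notation G := (clm g w).

(** Covariant derivative of the one-form with components [w]; for $w = d\omega$ it is the Hessian of
    $\omega$, and [nabw] is then differentiation along the gradient. *)
Definition hess i j := d i (w j) - \sum_p Gam i j p * w p.
Definition nabw v := \sum_j w j *: Nab j v.

Lemma hess_sym i j : hess i j = hess j i.
Proof.
have cE : \sum_p c i j p * w p =
    \sum_p Gam i j p * w p - \sum_p Gam j i p * w p.
  by rewrite -sumrB; apply: eq_bigr => p _; rewrite -christoffel_torsion mulrBl.
apply/eqP; rewrite -subr_eq0 /hess; apply/eqP.
transitivity (d i (w j) - d j (w i) - \sum_p c i j p * w p).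
  by rewrite cE; ring.
by rewrite w_closed subrr.
Qed.

Lemma clmD v x : G (v + x) = G v + G x.
Proof. by rewrite -big_split; apply: eq_bigr => i _; rewrite gD scalerDr. Qed.

Lemma clmZ a v : G (a *: v) = a *: G v.
Proof.
by rewrite scaler_sumr; apply: eq_bigr => i _; rewrite gZ !scalerA mulrC.
Qed.

Lemma clm0 : G 0 = 0.
Proof. by apply: (addrI (G 0)); rewrite -clmD !addr0. Qed.

Lemma clmS (I : Type) (r : seq I) (P : pred I) (f : I -> V) :
  G (\sum_(k <- r | P k) f k) = \sum_(k <- r | P k) G (f k).
Proof. exact: (big_morph _ clmD clm0). Qed.

Lemma clmN v : G (- v) = - G v.
Proof. by rewrite -scaleN1r clmZ scaleN1r. Qed.

Lemma clm_g i v : g i (G v) = - G (g i v) - (2 * w i) *: v.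
Proof.
rewrite frame_gS -sumrN -[w i](sum_delta w) mulr_sumr scaler_suml -sumrB.
apply: eq_bigr => j _; rewrite gZ frame_gC eq_sym.
by module_coefs A V; ring.
Qed.

Lemma clm_clm v : G (G v) = - ((\sum_i w i * w i) *: v).
Proof.
rewrite -(clifford_sym (S := fun i j => w i * w j)); last by move=> i j; rewrite mulrC.
apply: eq_bigr => i _; rewrite frame_gS scaler_sumr; apply: eq_bigr => j _.
by rewrite gZ scalerA.
Qed.

Lemma nab_clm i v : Nab i (G v) = G (Nab i v) + \sum_j hess i j *: g j v.
Proof.
rewrite nabS; under eq_bigr do rewrite nabZ nab_g scalerDr.
rewrite !big_split /= addrCA; congr (_ + _).
transitivity (\sum_j d i (w j) *: g j v - \sum_j (\sum_p Gam i j p * w p) *: g j v).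
  congr (_ + _); under eq_bigr do rewrite scaler_sumr.
  rewrite exchange_big -sumrN; apply: eq_bigr => j _.
  rewrite scaler_suml -sumrN; apply: eq_bigr => p _.
  by rewrite scalerA christoffel_antisym mulrN scaleNr mulrC.
by rewrite -sumrB; apply: eq_bigr => j _; rewrite scalerBl.
Qed.

Lemma dir_clm v :
  Dir (G v) = - ((\sum_i hess i i) *: v) - G (Dir v) - 2 *: nabw v.
Proof.
transitivity (\sum_i \sum_j hess i j *: g i (g j v)
    + \sum_i (- G (g i (Nab i v)) - (2 * w i) *: Nab i v)).
  rewrite -big_split; apply: eq_bigr => i _ /=.
  rewrite nab_clm gD clm_g addrC frame_gS; congr (_ + _).
  by apply: eq_bigr => j _; rewrite gZ.
rewrite (clifford_sym _ hess_sym) -addrA; congr (_ + _).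
rewrite sumrB; congr (_ - _).
  rewrite sumrN; congr (- _).
  by rewrite clmS.
by rewrite scaler_sumr; apply: eq_bigr => i _; rewrite scalerA.
Qed.

(** Commuting [Dir] with $\nabla_{\mathrm{grad}}$ differentiates [w], exchanges two covariant
    derivatives and rotates the Clifford generators. The curvature produced by the exchange is
    contracted with one generator, so [ricci_spin] reduces it to the Ricci tensor. *)
Lemma dir_nabw v :
  Dir (nabw v) = nabw (Dir v) + \sum_i \sum_j hess i j *: g i (Nab j v)
    + h *: \sum_j w j *: \sum_k Rc j k *: g k v.
Proof.
have L : Dir (nabw v) = \sum_i \sum_j d i (w j) *: g i (Nab j v)
    + \sum_i \sum_j w j *: g i (Nab i (Nab j v)).
  rewrite -big_split; apply: eq_bigr => i _ /=.
  rewrite nabS frame_gS -big_split; apply: eq_bigr => j _ /=.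
  by rewrite nabZ gD !gZ.
have E : nabw (Dir v) = \sum_i \sum_j w j *: g i (Nab j (Nab i v))
    + \sum_i \sum_j (\sum_p w p * Gam p i j) *: g j (Nab i v).
  rewrite exchange_big [X in _ + X](_ : _ =
    \sum_p w p *: \sum_i \sum_j Gam p i j *: g j (Nab i v)).
    rewrite -big_split; apply: eq_bigr => j _ /=.
    rewrite -scaler_sumr -scalerDr nabS -big_split; congr (_ *: _).
    by apply: eq_bigr => i _; rewrite nab_g.
  under [RHS]eq_bigr do rewrite scaler_sumr.
  rewrite [RHS]exchange_big; apply: eq_bigr => i _ /=.
  under [RHS]eq_bigr do rewrite scaler_sumr.
  rewrite [RHS]exchange_big; apply: eq_bigr => j _ /=.
  by rewrite scaler_suml; apply: eq_bigr => p _; rewrite scalerA.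
have C : \sum_i \sum_j w j *: g i (Nab i (Nab j v)) =
    \sum_i \sum_j w j *: g i (Nab j (Nab i v))
    + \sum_i \sum_j (\sum_p c i p j * w p) *: g i (Nab j v)
    + h *: \sum_j w j *: \sum_k Rc j k *: g k v.
  rewrite scaler_sumr [X in _ + X](_ : _ =
      \sum_i \sum_j w j *: g i (Quad (Rm i j) v)); last first.
    rewrite exchange_big; apply: eq_bigr => j _ /=.
    by rewrite -scaler_sumr ricci_spin !scalerA mulrC.
  rewrite -!big_split; apply: eq_bigr => i _ /=.
  transitivity (\sum_j w j *: g i (Nab j (Nab i v))
      + \sum_j \sum_p (c i j p * w j) *: g i (Nab p v)
      + \sum_j w j *: g i (Quad (Rm i j) v)).
    rewrite -!big_split; apply: eq_bigr => j _ /=.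
    rewrite -[Nab i (Nab j v)](subrK (Nab j (Nab i v))) nab_comm !gD frame_gS.
    rewrite !scalerDr (_ : \sum_p (c i j p * w j) *: g i (Nab p v) =
      w j *: \sum_p g i (c i j p *: Nab p v)); first by module_coefs A V; ring.
    by rewrite scaler_sumr; apply: eq_bigr => p _; rewrite gZ scalerA mulrC.
  congr (_ + _ + _); rewrite exchange_big; apply: eq_bigr => j _ /=.
  by rewrite scaler_suml.
rewrite L C E.
set X := \sum_i \sum_j w j *: _; set Y := h *: _.
(* The structure functions account exactly for what remains: the Christoffel part of [hess] and the
   rotation of the generators in [nabw (Dir v)]. This is torsion freeness together with antisymmetry
   of [Gam]. *)
rewrite [X in _ + (_ + X + _)](_ : _ =
  \sum_i \sum_j (hess i j - d i (w j)) *: g i (Nab j v)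
  + \sum_i \sum_j (\sum_p w p * Gam p i j) *: g j (Nab i v)).
  rewrite (_ : \sum_i \sum_j (hess i j - d i (w j)) *: g i (Nab j v) =
    \sum_i \sum_j hess i j *: g i (Nab j v)
    - \sum_i \sum_j d i (w j) *: g i (Nab j v)).
    by module_coefs A V; ring.
  rewrite -sumrB; apply: eq_bigr => i _; rewrite -sumrB; apply: eq_bigr => j _.
  by rewrite scalerBl.
rewrite [X in _ = _ + X]exchange_big -big_split; apply: eq_bigr => i _ /=.
rewrite -big_split; apply: eq_bigr => j _ /=; rewrite -scalerDl; congr (_ *: _).
rewrite (_ : \sum_p c i p j * w p =
  \sum_p w p * Gam p j i - \sum_p Gam i j p * w p); first by rewrite /hess; ring.
rewrite -sumrB; apply: eq_bigr => p _.
by rewrite -christoffel_torsion (christoffel_antisym i p j) (christoffel_antisym p j i); ring.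
Qed.
(** Anticommuting twice with [dir_clm] makes the [nabw] terms a commutator, evaluated by [dir_nabw];
    the factor 2 in front turns the 1/2 of its Ricci term into 1. *)
Lemma dir2_clm v :
  Dir (Dir (G v)) = G (Dir (Dir v)) - clm g (fun i => d i (\sum_j hess j j)) v
    - 2 *: \sum_i \sum_j hess i j *: g i (Nab j v)
    - \sum_j w j *: \sum_k Rc j k *: g k v.
Proof.
have d2 i : d i 2 = 0 by apply: frame_dnat.
rewrite {1}dir_clm !dirD !dirN dirZ (dir_const _ d2) dir_clm dir_nabw.
module_coefs A V; [ring..|].
by transitivity (- (2 * h)); [ring | rewrite h2; ring].
Qed.

(** Metric compatibility: antisymmetry of [Gam] in its last two indices makes [Z] vanish, so
    [d i (w j)] may be traded for [hess i j]. *)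
Lemma d_sqnorm i : d i (\sum_j w j * w j) = 2 * \sum_j hess i j * w j.
Proof.
rewrite frame_dS; under eq_bigr do rewrite dM.
have Z : \sum_j \sum_p Gam i j p * w p * w j = 0.
  apply: self_opp0; rewrite {1}exchange_big -sumrN; apply: eq_bigr => j _ /=.
  rewrite -sumrN; apply: eq_bigr => p _; rewrite christoffel_antisym; ring.
transitivity (2 * ((\sum_j hess i j * w j)
    + \sum_j \sum_p Gam i j p * w p * w j)); last by rewrite Z addr0.
rewrite -big_split mulr_sumr; apply: eq_bigr => j _ /=.
by rewrite /hess -mulr_suml; ring.
Qed.

(** Isolates the trace [tau], whose conformal change is simple, and leaves four sums that can be
    transformed one by one. Torsion freeness removes the structure functions; two products then
    cancel on exchanging i and p. *)
Lemma ricci_trace j k : let tau k := \sum_i Gam i k i in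
  Rc j k = \sum_i d i (Gam j k i) - d j (tau k) + \sum_p Gam j k p * tau p
    - \sum_i \sum_p Gam i j p * Gam p k i.
Proof.
move=> tau.
have E i : Rm i j k i = d i (Gam j k i) - d j (Gam i k i)
    + \sum_p Gam j k p * Gam i p i - \sum_p Gam i j p * Gam p k i
    + (\sum_p Gam j i p * Gam p k i - \sum_p Gam i k p * Gam j p i).
  rewrite /curv -!addrA; congr (_ + (_ + _)).
  rewrite -!sumrN -!big_split; apply: eq_bigr => p _ /=.
  by rewrite -christoffel_torsion; ring.
rewrite /ricci; under eq_bigr do rewrite E.
rewrite big_split /= [X in _ + X](_ : _ = 0) ?addr0; last first.
  rewrite sumrB [X in X - _]exchange_big; apply/eqP; rewrite subr_eq0; apply/eqP.
  by apply: eq_bigr => i _; apply: eq_bigr => p _; rewrite mulrC.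
rewrite sumrB big_split sumrB /= -frame_dS; congr (_ + _ - _).
by rewrite exchange_big; apply: eq_bigr => p _; rewrite mulr_sumr.
Qed.


(** * Vector fields by frame components and the Koszul formula *)

Definition dact (x : 'I_n -> A) (a : A) := \sum_i x i * d i a.

(** General components are needed because [riem] applies the connection to fields outside the frame,
    such as $\nabla_{e_j} e_k$ and $[e_i, e_j]$. *)
Definition brac (x y : 'I_n -> A) k :=
  \sum_i (x i * d i (y k) - y i * d i (x k))
  + \sum_i \sum_j x i * y j * c i j k.

Definition lcv (x y : 'I_n -> A) k :=
  \sum_i x i * d i (y k) + \sum_i \sum_j x i * y j * Gam i j k.

Definition delta k : 'I_n -> A := fun i => (i == k)%:R.

Lemma sum_deltar (f : 'I_n -> A) j : \sum_i f i * (i == j)%:R = f j.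
Proof. by rewrite -[RHS]sum_delta; apply: eq_bigr => i _; rewrite mulrC. Qed.

Lemma dact_delta k a : dact (delta k) a = d k a.
Proof. exact: (sum_delta (fun i => d i a)). Qed.

Lemma dact_brac x y a :
  dact x (\sum_k y k * d k a) - dact y (\sum_k x k * d k a) =
  \sum_p brac x y p * d p a.
Proof.
have E z t : dact z (\sum_k t k * d k a) = \sum_k (\sum_i z i * d i (t k)) * d k a
    + \sum_i \sum_k z i * t k * d i (d k a).
  rewrite [X in X + _](_ : _ = \sum_i \sum_k z i * d i (t k) * d k a).
    rewrite -big_split; apply: eq_bigr => i _ /=.
    rewrite frame_dS mulr_sumr -big_split; apply: eq_bigr => k _ /=.
    by rewrite dM; ring.
  by rewrite exchange_big; apply: eq_bigr => k _; rewrite mulr_suml.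
rewrite !E [X in _ - (_ + X)]exchange_big /= opprD addrACA -sumrB -[X in _ + X]sumrB.
rewrite [X in _ + X](_ : _ = \sum_p (\sum_i \sum_j x i * y j * c i j p) * d p a).
  rewrite -big_split; apply: eq_bigr => p _ /=.
  by rewrite /brac mulrDl sumrB mulrBl.
under [RHS]eq_bigr do rewrite mulr_suml.
rewrite [RHS]exchange_big; apply: eq_bigr => i _ /=; rewrite -sumrB.
under [RHS]eq_bigr do rewrite mulr_suml.
rewrite [RHS]exchange_big; apply: eq_bigr => j _ /=.
transitivity (x i * y j * (d i (d j a) - d j (d i a))); first by ring.
by rewrite (fa_comm fa) mulr_sumr; apply: eq_bigr => p _; ring.
Qed.

Lemma brac_deltar y k i :
  brac y (delta k) i = - d k (y i) + \sum_a y a * c a k i.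
Proof.
rewrite /brac; congr (_ + _).
  rewrite -(sum_delta (fun j => d j (y i))) -sumrN; apply: eq_bigr => j _.
  by rewrite /delta frame_dnat; ring.
apply: eq_bigr => a _; rewrite -(sum_delta (fun j => c a j i) k) mulr_sumr.
by apply: eq_bigr => j _; rewrite /delta; ring.
Qed.

Lemma brac_deltal x k i :
  brac (delta k) x i = d k (x i) + \sum_b x b * c k b i.
Proof.
rewrite /brac; congr (_ + _).
  rewrite -[RHS](sum_delta (fun j => d j (x i))); apply: eq_bigr => j _.
  by rewrite /delta frame_dnat; ring.
rewrite exchange_big; apply: eq_bigr => b _ /=.
rewrite -(sum_delta (fun j => c j b i) k) mulr_sumr.
by apply: eq_bigr => j _; rewrite /delta; ring.
Qed.

(** The derivatives of components along $e_k$ cancel between the metric and the bracket terms, and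
    those along x add up to twice $x(y_k)$. What remains is the Koszul combination of structure
    functions. *)
Lemma koszul_delta x y k :
  h * (dact x (\sum_i y i * delta k i) + dact y (\sum_i delta k i * x i)
       - dact (delta k) (\sum_i x i * y i) + \sum_i brac x y i * delta k i
       - \sum_i brac y (delta k) i * x i + \sum_i brac (delta k) x i * y i) =
  lcv x y k.
Proof.
rewrite sum_deltar sum_deltar sum_delta dact_delta frame_dS.
rewrite [\sum_i d k (x i * y i)](_ : _ =
  \sum_i d k (x i) * y i + \sum_i d k (y i) * x i); last first.
  by rewrite -big_split; apply: eq_bigr => i _ /=; rewrite dM; ring.
rewrite [\sum_i brac y _ i * x i](_ : _ = - \sum_i d k (y i) * x i
    + \sum_i \sum_j x i * y j * c j k i); last first.
  rewrite -sumrN -big_split; apply: eq_bigr => i _ /=.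
  rewrite brac_deltar mulrDl mulNr mulr_suml; congr (_ + _).
  by apply: eq_bigr => j _; ring.
rewrite [\sum_i brac _ x i * y i](_ : _ = \sum_i d k (x i) * y i
    + \sum_i \sum_j x i * y j * c k i j); last first.
  rewrite exchange_big -big_split; apply: eq_bigr => i _ /=.
  rewrite brac_deltal mulrDl mulr_suml; congr (_ + _).
  by apply: eq_bigr => j _; ring.
rewrite /lcv [X in _ = _ + X](_ : _ = h * (\sum_i \sum_j x i * y j * c i j k
    - \sum_i \sum_j x i * y j * c j k i + \sum_i \sum_j x i * y j * c k i j)).
  rewrite /brac sumrB /dact -[X in _ = X + _]mul1r -h2; ring.
rewrite -sumrB -big_split mulr_sumr; apply: eq_bigr => i _ /=.
rewrite -sumrB -big_split mulr_sumr; apply: eq_bigr => j _ /=.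
by rewrite /christoffel; ring.
Qed.

Lemma lcv_deltal i y l : lcv (delta i) y l = d i (y l) + \sum_b y b * Gam i b l.
Proof.
rewrite /lcv; congr (_ + _); first exact: (sum_delta (fun a => d a (y l))).
rewrite -(sum_delta (fun a => \sum_b y b * Gam a b l) i).
apply: eq_bigr => a _; rewrite mulr_sumr; apply: eq_bigr => b _.
by rewrite /delta; ring.
Qed.

Lemma lcv_deltar x k l : lcv x (delta k) l = \sum_a x a * Gam a k l.
Proof.
rewrite /lcv big1 ?add0r; last by move=> a _; rewrite /delta frame_dnat mulr0.
apply: eq_bigr => a _; rewrite -(sum_delta (fun b => Gam a b l) k) mulr_sumr.
by apply: eq_bigr => b _; rewrite /delta; ring.
Qed.

Lemma lcv_delta i j k : lcv (delta i) (delta j) k = Gam i j k.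
Proof.
by rewrite lcv_deltal /delta frame_dnat add0r (sum_delta (fun b => Gam i b k)).
Qed.

Lemma curv_lcv i j k l :
  lcv (delta i) (Gam j k) l - lcv (delta j) (Gam i k) l
  - lcv (c i j) (delta k) l = Rm i j k l.
Proof.
rewrite !lcv_deltal lcv_deltar /curv !sumrB; ring.
Qed.

End FrameTheory.

(** * Conformal change of the frame *)

Section Conformal.
Variables (A : comPzRingType) (V : lmodType A) (n : nat).
Variables (d : 'I_n -> A -> A) (dV : 'I_n -> V -> V) (g : 'I_n -> V -> V).
Variable (c : 'I_n -> 'I_n -> 'I_n -> A).
Hypothesis fa : frame_axioms d dV g c.
Variables (u om : A) (c' : 'I_n -> 'I_n -> 'I_n -> A).
Let d' i a := u * d i a.
Let dV' i v := u *: dV i v.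
Hypothesis fa' : frame_axioms d' dV' g c'.
Let w i := d i om.
Hypothesis du : forall i, d i u = - (u * w i).
Variables (h h3 : A).
Hypothesis (h2 : 2 * h = 1) (h3E : 3 * h3 = 1).

Local Notation Gam := (christoffel c h).
Local Notation Rc := (ricci d c h).
Local Notation Sc := (scalar d c h).
Local Notation Nab := (nab dV g c h).
Local Notation Quad := (quad g h).
Local Notation Dir := (dir dV g c h).
Local Notation G := (clm g w).
Local Notation Hs := (hess d c h w).
Local Notation N := (n%:R : A).
Local Notation "''d_' ( i , j )" := ((i == j)%:R : A) (at level 8).

Let t := \sum_i Hs i i.
Let b := \sum_i w i * w i.

Lemma closed_dom i j : d i (w j) - d j (w i) = \sum_p c i j p * w p.
Proof. exact: (fa_comm fa). Qed.

(** [c'] is known only through the axioms for [d'], so it is identified by [fa_inj] from the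
    commutator of $u d_i$ and $u d_j$, where [du] accounts for the derivatives of u. *)
Lemma conf_bracket i j k :
  c' i j k = u * (c i j k - w i * 'd_(j, k) + w j * 'd_(i, k)).
Proof.
pose x k := c' i j k - u * (c i j k - w i * 'd_(j, k) + w j * 'd_(i, k)).
suff x0 : forall p, x p = 0.
  by apply/eqP; rewrite -subr_eq0; apply/eqP; apply: (x0 k).
apply: (fa_inj fa') => a.
transitivity (\sum_p c' i j p * d' p a - (u * u) * (\sum_p c i j p * d p a
  - w i * \sum_p (p == j)%:R * d p a + w j * \sum_p (p == i)%:R * d p a)).
  rewrite !mulr_sumr -sumrN -!big_split /= mulr_sumr -sumrN -big_split.
  apply: eq_bigr => p _ /=; rewrite /x /d' (eq_sym p j) (eq_sym p i); ring.
rewrite !sum_delta -(fa_comm fa) -(fa_comm fa') /d' !(fa_dM fa) !du; ring.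
Qed.

Lemma conf_christoffel i j k :
  christoffel c' h i j k = u * (Gam i j k + w j * 'd_(i, k) - w k * 'd_(i, j)).
Proof.
rewrite /christoffel !conf_bracket (eq_sym k j) (eq_sym j i) (eq_sym k i).
transitivity (u * (h * (c i j k - c j k i + c k i j)
   + (2 * h) * (w j * 'd_(i, k) - w k * 'd_(i, j)))); first by ring.
by rewrite h2; ring.
Qed.

(** The change of the connection is the antisymmetric matrix $w_a \delta_{ib} - w_b \delta_{ia}$.
    Its double Clifford sum is $G g_i - g_i G$, which [clm_g] turns into $-2(g_i G + w_i)$. *)
Lemma conf_nab i v : nab dV' g c' h i v =
  u *: (Nab i v - h *: g i (G v) - (h * w i) *: v).
Proof.
have Q : \sum_a \sum_b (w a * 'd_(i, b) - w b * 'd_(i, a)) *: g a (g b v) =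
    - 2 *: (g i (G v) + w i *: v).
  transitivity (G (g i v) - g i (G v)); last first.
    rewrite (clm_g fa w) [G (g i v)](_ : _ = - g i (G v) - (2 * w i) *: v).
      by rewrite (clm_g fa w); module_coefs A V; ring.
    by rewrite (clm_g fa w); module_coefs A V; ring.
  rewrite -(sum_deltaZ (fun a => g a (G v)) i) -sumrB; apply: eq_bigr => a _.
  rewrite -(sum_deltaZ (fun b => w a *: g a (g b v)) i) (frame_gS fa).
  rewrite scaler_sumr -sumrB; apply: eq_bigr => b' _.
  rewrite (fa_gZ fa) (eq_sym i b') (eq_sym i a).
  by module_coefs A V; ring.
rewrite /nab.
have -> : quad g h (christoffel c' h i) v = u *: (Quad (Gam i) v
    + (h * h) *: (- 2 *: (g i (G v) + w i *: v))).
  rewrite -Q -quad_add -quad_scale; apply: eq_quad => a b'.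
  by rewrite conf_christoffel; ring.
rewrite -scalerDr; congr (_ *: _); rewrite !scalerA.
have -> : h * h * (- 2) = - h by transitivity (- ((2 * h) * h)); [ring | rewrite h2; ring].
by module_coefs A V; ring.
Qed.

Lemma g_sq i v : g i (g i v) = - v.
Proof.
rewrite (half_eq h2 (x := (-2) *: v) (v := g i (g i v))).
  by rewrite scalerA mulrN [h * 2]mulrC h2 scaleN1r.
apply/eqP; rewrite eq_sym subr_eq eq_sym (fa_clifford fa) eqxx; apply/eqP.
by rewrite mulr1.
Qed.

(** In the factor n - 1, the n comes from $-\sum_i g_i g_i$ and the -1 from contracting $w_i$ with
    $g_i$. *)
Lemma conf_dir v :
  dir dV' g c' h v = u *: (Dir v + (h * (N - 1)) *: G v).
Proof.
have E x : \sum_i (g i (Nab i v) + h *: x - h *: (w i *: g i v)) =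
    Dir v + h *: (N *: x) - h *: \sum_i w i *: g i v.
  rewrite sumrB -scaler_sumr big_split sumr_const card_ord /=.
  by rewrite scaler_nat scalerMnr.
transitivity (u *: \sum_i (g i (Nab i v) + h *: G v - h *: (w i *: g i v))).
  rewrite scaler_sumr; apply: eq_bigr => i _ /=.
  rewrite conf_nab (fa_gZ fa) !(frame_gB fa) !(fa_gZ fa) g_sq.
  by module_coefs A V; ring.
by rewrite E -/(clm g w v); module_coefs A V; ring.
Qed.

Lemma conf_tau k :
  \sum_i christoffel c' h i k i = u * (\sum_i Gam i k i + (N - 1) * w k).
Proof.
transitivity (u * (\sum_i Gam i k i + \sum_(i < n) w k
    - \sum_i (i == k)%:R * w i)).
  rewrite -sumrN -!big_split mulr_sumr; apply: eq_bigr => i _ /=.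
  by rewrite conf_christoffel eqxx mulr1; ring.
by rewrite sum_delta sumr_const card_ord -mulr_natl; ring.
Qed.

(** The classical law for $e^{2\omega} h$, with [u * u] because both components refer to the
    rescaled frame. [P1] to [P4] transform the four sums of [ricci_trace]. *)
Lemma conf_ricci j k : ricci d' c' h j k = u * u *
  (Rc j k - (N - 2) * (Hs j k - w j * w k) - 'd_(j, k) * (t + (N - 2) * b)).
Proof.
pose tau k := \sum_i Gam i k i.
have tE : t = \sum_i d i (w i) + \sum_p w p * tau p.
  rewrite /t sumrB; congr (_ + _); rewrite exchange_big -sumrN.
  apply: eq_bigr => p _; rewrite mulr_sumr -sumrN; apply: eq_bigr => i _ /=.
  by rewrite (christoffel_antisym fa); ring.
have P1 : \sum_i d' i (christoffel c' h j k i) = u * u * (\sum_i d i (Gam j k i)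
    + d j (w k) - 'd_(j, k) * \sum_i d i (w i) - \sum_i Gam j k i * w i
    - w j * w k + 'd_(j, k) * b).
  (* Terms without a summation index are turned into sums against a Kronecker delta, so that the two
     sides can be compared summand by summand; [P3] and [P4] use the same device. *)
  rewrite -(sum_delta (fun i => d i (w k)) j) -(sum_delta (fun i => w i * w k) j).
  rewrite /b !mulr_sumr -!sumrN -!big_split mulr_sumr; apply: eq_bigr => i _ /=.
  rewrite conf_christoffel /d' !(fa_dM fa, frame_dB fa, fa_dD fa, frame_dnat fa) du.
  by rewrite (eq_sym j i); ring.
have P2 : d' j (\sum_i christoffel c' h i k i) = u * u *
    (d j (tau k) + (N - 1) * d j (w k) - w j * (tau k + (N - 1) * w k)).
  rewrite conf_tau /d' !(fa_dM fa, frame_dB fa, fa_dD fa, frame_dnat fa) du.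
  by rewrite (frame_dN fa) (frame_d1 fa) /tau; ring.
have P3 : \sum_p christoffel c' h j k p * \sum_i christoffel c' h i p i = u * u *
    (\sum_p Gam j k p * tau p + (N - 1) * \sum_p Gam j k p * w p
     + w k * (tau j + (N - 1) * w j)
     - 'd_(j, k) * (\sum_p w p * tau p + (N - 1) * b)).
  rewrite -(sum_delta (fun p => tau p + (N - 1) * w p) j) /b.
  rewrite !(mulrDr 'd_(j, k)) !mulr_sumr -!big_split -sumrN -!big_split /=.
  rewrite mulr_sumr; apply: eq_bigr => p _ /=.
  by rewrite conf_tau conf_christoffel -/(tau p) (eq_sym j p); ring.
have P4 : \sum_i \sum_p christoffel c' h i j p * christoffel c' h p k i = u * u *
    (\sum_i \sum_p Gam i j p * Gam p k i + w k * tau j + w j * tau k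
     + (N - 1) * (w j * w k)).
  have E i : \sum_p christoffel c' h i j p * christoffel c' h p k i = u * u *
     (\sum_p Gam i j p * Gam p k i + w k * Gam i j i - w i * Gam i j k
      + w j * Gam i k i + w j * w k - (i == k)%:R * (w i * w j)
      - (i == j)%:R * \sum_p w p * Gam p k i).
    rewrite -(sum_delta (fun p => w k * Gam i j p) i).
    rewrite -(sum_delta (fun p => w j * Gam p k i) i).
    rewrite -(sum_delta (fun p => w i * Gam i j p) k).
    transitivity (u * u * (\sum_p Gam i j p * Gam p k i
        + \sum_p (p == i)%:R * (w k * Gam i j p)
        - \sum_p (p == k)%:R * (w i * Gam i j p)
        + \sum_p (p == i)%:R * (w j * Gam p k i)
        + (\sum_p (p == i)%:R * ((p == i)%:R * (w j * w k)))
        - (\sum_p (p == i)%:R * ((p == k)%:R * (w i * w j)))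
        - (i == j)%:R * \sum_p w p * Gam p k i
        - (\sum_p (p == i)%:R * ((i == j)%:R * (w p * w k)))
        + (\sum_p (p == k)%:R * ((i == j)%:R * (w p * w i))))).
      rewrite !mulr_sumr -!sumrN -!big_split mulr_sumr.
      apply: eq_bigr => p _ /=; rewrite !conf_christoffel (eq_sym i p); ring.
    by rewrite !sum_delta eqxx mul1r; ring.
  under eq_bigr do rewrite E.
  rewrite -mulr_sumr !(sumrB, big_split) /= !sum_delta sumr_const card_ord.
  rewrite -[\sum_i w k * _]mulr_sumr -[\sum_i w j * _]mulr_sumr.
  rewrite -[_ *+ n]mulr_natl -/(tau j) -/(tau k).
  have -> : \sum_i w i * Gam i j k = - \sum_p w p * Gam p k j.
    by rewrite -sumrN; apply: eq_bigr => p _; rewrite (christoffel_antisym fa); ring.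
  by ring.
rewrite (ricci_trace fa' h2) P1 P2 P3 P4 (ricci_trace fa h2) tE /hess.
rewrite -/(tau k).
by ring.
Qed.

Lemma conf_scalar : scalar d' c' h =
  u * u * (Sc - 2 * (N - 1) * t - (N - 1) * (N - 2) * b).
Proof.
rewrite /scalar; under eq_bigr do rewrite conf_ricci eqxx.
rewrite -mulr_sumr !sumrB -mulr_sumr sumrB sumr_const card_ord -/t -/b.
by rewrite mulr1n -mulr_natl; ring.
Qed.

(** A tensor contracted with the connection of the new metric; this separates the change of $\nabla$
    from that of Ric. *)
Let phi (S : 'I_n -> 'I_n -> A) v :=
  \sum_i \sum_j S i j *: g i (nab dV' g c' h j v).

Lemma conf_phi S v : (forall i j, S i j = S j i) -> phi S v =
  u *: (\sum_i \sum_j S i j *: g i (Nab j v) + h *: ((\sum_i S i i) *: G v)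
        - h *: \sum_i \sum_j S i j *: (w j *: g i v)).
Proof.
move=> Ssym.
transitivity (u *: (\sum_i \sum_j S i j *: g i (Nab j v)
    - h *: \sum_i \sum_j S i j *: g i (g j (G v))
    - h *: \sum_i \sum_j S i j *: (w j *: g i v))).
  rewrite !scaler_sumr -!sumrN -!big_split scaler_sumr; apply: eq_bigr => i _ /=.
  rewrite !scaler_sumr -!sumrN -!big_split scaler_sumr; apply: eq_bigr => j _ /=.
  rewrite conf_nab (fa_gZ fa) !(frame_gB fa) !(fa_gZ fa).
  by module_coefs A V; ring.
by rewrite (clifford_sym fa h2 _ Ssym); module_coefs A V; ring.
Qed.

Lemma clm_db v :
  clm g (fun i => d i b) v = 2 *: \sum_i \sum_j Hs i j *: (w j *: g i v).
Proof.
rewrite scaler_sumr; apply: eq_bigr => i _.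
rewrite (d_sqnorm fa h2) -scalerA scaler_suml; congr (_ *: _).
by apply: eq_bigr => j _; rewrite scalerA.
Qed.

(** [conf_ricci] splits the new Ricci tensor into Rc, the Hessian, $w \otimes w$ and a multiple of
    $\delta$. The first three are symmetric and handled by [conf_phi]; $\delta$ reproduces the Dirac
    operator. *)
Lemma conf_clric v : clric d' dV' g c' h v = (u * u * u) *:
  (clric d dV g c h v + h *: (Sc *: G v)
   - h *: \sum_i \sum_j Rc i j *: (w j *: g i v)
   - (N - 2) *: (\sum_i \sum_j Hs i j *: g i (Nab j v) + (h * t) *: G v
                 - h *: \sum_i \sum_j Hs i j *: (w j *: g i v))
   + (N - 2) *: G (nabw dV g c h w v)
   - (t + (N - 2) * b) *: (Dir v + (h * (N - 1)) *: G v)).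
Proof.
have clricE : clric d' dV' g c' h v = (u * u) *: (phi Rc v - (N - 2) *:
    (phi Hs v - phi (fun i j => w i * w j) v)
    - (t + (N - 2) * b) *: dir dV' g c' h v).
  transitivity ((u * u) *: (phi Rc v - (N - 2) *:
    (phi Hs v - phi (fun i j => w i * w j) v)
    - (t + (N - 2) * b) *: phi (fun i j => 'd_(j, i)) v)).
    rewrite /phi !scaler_sumr -!sumrN -!big_split scaler_sumr -!sumrN -!big_split.
    rewrite !scaler_sumr; apply: eq_bigr => i _ /=.
    rewrite -!sumrN -!big_split !scaler_sumr -!sumrN -!big_split scaler_sumr.
    apply: eq_bigr => j _ /=; rewrite conf_ricci (eq_sym i j).
    by module_coefs A V; ring.
  by congr (_ *: (_ - _ *: _)); apply: eq_bigr => i _; rewrite sum_deltaZ.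
rewrite clricE (conf_phi _ (ricci_sym fa h2)) (conf_phi _ (hess_sym fa h2 closed_dom)).
rewrite conf_phi; last by move=> i j; rewrite mulrC.
rewrite conf_dir -/t -/b -/(scalar d c h).
have -> : \sum_i \sum_j (w i * w j) *: g i (Nab j v) = G (nabw dV g c h w v).
  apply: eq_bigr => i _; rewrite (frame_gS fa) scaler_sumr.
  by apply: eq_bigr => j _; rewrite (fa_gZ fa) scalerA.
have -> : \sum_i \sum_j (w i * w j) *: (w j *: g i v) = b *: G v.
  rewrite scaler_sumr; apply: eq_bigr => i _; rewrite scalerA mulr_suml.
  by rewrite scaler_suml; apply: eq_bigr => j _; rewrite scalerA; congr (_ *: _); ring.
rewrite /clric.
by module_coefs A V; ring.
Qed.

(* Dir (G (Dir v)) need not be expanded: in the application its coefficient a2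
   is the same for both metrics. *)
Lemma dir_cube a1 a2 a3 v :
  (forall i, d i a1 = 0) -> (forall i, d i a2 = 0) ->
  let x1 := Dir v + a1 *: G v in let x2 := Dir x1 + a2 *: G x1 in
  Dir x2 + a3 *: G x2 =
  Dir (Dir (Dir v)) + (a1 + a3) *: G (Dir (Dir v))
  - a1 *: (clm g (fun i => d i t) v + 2 *: \sum_i \sum_j Hs i j *: g i (Nab j v)
           + \sum_i \sum_j Rc i j *: (w j *: g i v))
  + a2 *: Dir (G (Dir v))
  - (2 * (a2 * a1)) *: \sum_i \sum_j Hs i j *: (w j *: g i v)
  + (a3 * a1 - a2 * a1 - a3 * a2) *: (b *: Dir v)
  - (a3 * a1) *: (t *: G v + 2 *: G (nabw dV g c h w v))
  - (a3 * a2 * a1) *: (b *: G v).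
Proof.
move=> da1 da2 x1 x2; rewrite /x2 /x1.
have RE : \sum_j w j *: (\sum_k Rc j k *: g k v) =
    \sum_i \sum_j Rc i j *: (w j *: g i v).
  rewrite exchange_big; apply: eq_bigr => j _ /=; rewrite scaler_sumr.
  by apply: eq_bigr => k _; rewrite (ricci_sym fa h2) !scalerA mulrC.
have da12 i : d i (a2 * a1) = 0 by rewrite (fa_dM fa) da1 da2 mul0r mulr0 addr0.
rewrite !(dirD fa, clmD fa, clmZ fa,
  fun x => dir_const fa h x da1, fun x => dir_const fa h x da2).
rewrite !(clm_clm fa h2) (dir2_clm fa h2 h3E closed_dom) RE -/t -/b.
rewrite !(dirN fa) !(dirZ fa) (dir_clm fa h2 closed_dom v) -/t.
rewrite !(clmD fa, clmN fa, clmZ fa) !(clm_clm fa h2) -/b clm_db.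
by module_coefs A V; ring.
Qed.

(** * Comparison of the operators of the two metrics *)

Variables (f fi q1 q2 : A).
Hypothesis (q1E : q1 * (N - 1) = 1) (q2E : q2 * (N - 2) = 1).
Let m := h * (N - 3).
Hypothesis (df : forall i, d i f = m * (f * w i)) (ffi : fi * f = 1).

(** As (n - 1)/2 = m + 1, one factor is $u (D + (m+1) G)$. Pulling out a factor whose logarithmic
    derivative is k w shifts the coefficient by k ([Du]): u gives m, and u * u gives m - 1. *)
Lemma conf_dir3 v :
  dir dV' g c' h (dir dV' g c' h (dir dV' g c' h v)) =
  u * u * u *: (let x1 := Dir v + (m + 1) *: G v in
                let x2 := Dir x1 + m *: G x1 in Dir x2 + (m - 1) *: G x2).
Proof.
have D1 x : dir dV' g c' h x = u *: (Dir x + (m + 1) *: G x).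
  rewrite conf_dir; congr (_ *: (_ + _ *: _)).
  transitivity (h * (N - 3) + 2 * h); [by ring | by rewrite h2].
have Du a k x : (forall i, d i a = k * (a * w i)) ->
    dir dV' g c' h (a *: x) = (u * a) *: (Dir x + (m + 1 + k) *: G x).
  move=> da; rewrite (dirZ fa') D1 (_ : clm g (fun i => d' i a) x = (u * k * a) *: G x).
    by module_coefs A V; ring.
  rewrite scaler_sumr; apply: eq_bigr => i _.
  by rewrite /d' da scalerA; congr (_ *: _); ring.
rewrite (D1 v) (Du u (-1)); last by move=> i; rewrite du mulN1r.
rewrite (Du (u * u) (- 2)).
  by rewrite addrK (_ : m + 1 - 2 = m - 1); [rewrite mulrA | ring].
by move=> i; rewrite (fa_dM fa) du; ring.
Qed.

(** [f] stands for $e^{m\omega}$ and is known only through its logarithmic derivative [df]. *)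
Lemma gauge_dir x : Dir (f *: x) = f *: (Dir x + m *: G x).
Proof.
rewrite (dirZ fa) (_ : clm g (fun i => d i f) x = (m * f) *: G x).
  by module_coefs A V; ring.
rewrite scaler_sumr; apply: eq_bigr => i _.
by rewrite df scalerA; congr (_ *: _); ring.
Qed.

Lemma gauge_clric v : (2 * q2) *: clric d dV g c h (f *: v) =
  f *: ((2 * q2) *: clric d dV g c h v
        + (1 - q2) *: \sum_i \sum_j Rc i j *: (w j *: g i v)).
Proof.
(* Here $2m = n - 3 = (n-2) - 1$, and [q2] inverts n - 2. *)
have -> : 1 - q2 = 2 * q2 * m.
  transitivity (q2 * (N - 2) - 2 * h * q2); first by rewrite q2E h2; ring.
  transitivity (2 * h * (q2 * (N - 3))); last by rewrite /m; ring.
  by rewrite h2; ring.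
have E : clric d dV g c h (f *: v) = f *: (clric d dV g c h v
    + m *: \sum_i \sum_j Rc i j *: (w j *: g i v)).
  rewrite scaler_sumr -big_split scaler_sumr; apply: eq_bigr => i _ /=.
  rewrite scaler_sumr -big_split scaler_sumr; apply: eq_bigr => j _ /=.
  rewrite (nabZ fa) df (fa_gD fa) !(fa_gZ fa).
  by module_coefs A V; ring.
by rewrite E; module_coefs A V; ring.
Qed.

(** The coefficient [h * q1] is the inverse of 2(n - 1), hence dt appears with coefficient 1, as in
    the difference of the cubes. The multiple of [G v] comes from differentiating [u * u]. *)
Lemma conf_clm_scalar v :
  (h * q1) *: clm g (fun i => d' i (scalar d' c' h)) v = (u * u * u) *:
  ((h * q1) *: clm g (fun i => d i Sc) v - clm g (fun i => d i t) v
   - (N - 2) *: \sum_i \sum_j Hs i j *: (w j *: g i v)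
   - (q1 * Sc - 2 * t - (N - 2) * b) *: G v).
Proof.
have E : clm g (fun i => d' i (scalar d' c' h)) v = (u * u * u) *:
  (clm g (fun i => d i Sc) v - (2 * (N - 1)) *: clm g (fun i => d i t) v
   - ((N - 1) * (N - 2)) *: clm g (fun i => d i b) v
   - 2 *: ((Sc - 2 * (N - 1) * t - (N - 1) * (N - 2) * b) *: G v)).
  rewrite /clm !scaler_sumr -!sumrN -!big_split scaler_sumr.
  apply: eq_bigr => i _ /=; rewrite conf_scalar /d'.
  rewrite !(fa_dM fa, frame_dB fa, fa_dD fa, frame_dnat fa) du.
  rewrite !(frame_dN fa, frame_dnat fa, frame_d1 fa).
  by module_coefs A V; ring.
rewrite E clm_db.
transitivity ((u * u * u) *: ((h * q1) *: clm g (fun i => d i Sc) v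
   - (2 * h * (q1 * (N - 1))) *: clm g (fun i => d i t) v
   - (2 * h * (q1 * (N - 1)) * (N - 2)) *:
       \sum_i \sum_j Hs i j *: (w j *: g i v)
   - (2 * h * (q1 * Sc - q1 * (N - 1) * (2 * t + (N - 2) * b))) *: G v)).
  by module_coefs A V; ring.
rewrite h2 q1E !mul1r scale1r; congr (_ *: (_ - _ *: _)); ring.
Qed.

Lemma conf_scalar_dir v :
  (scalar d' c' h * (q1 * q2)) *: dir dV' g c' h v = (u * u * u) *:
  ((Sc * (q1 * q2) - 2 * q2 * t - b) *: (Dir v + (m + 1) *: G v)).
Proof.
have mE : m + 1 = h * (N - 1).
  transitivity (h * (N - 3) + 2 * h); [by rewrite h2 | by ring].
rewrite conf_dir conf_scalar mE !scalerA; congr (_ *: _).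
transitivity (u * u * u * (Sc * (q1 * q2) - 2 * (q1 * (N - 1)) * q2 * t
  - (q1 * (N - 1)) * (q2 * (N - 2)) * b)); first by ring.
by rewrite q1E q2E; ring.
Qed.

Lemma gauge_L1 v : L1a d dV g c h q1 q2 (f *: v) = f *:
  (let x1 := Dir v + m *: G v in let x2 := Dir x1 + m *: G x1 in
   Dir x2 + m *: G x2 - (h * q1) *: clm g (fun i => d i Sc) v
   - ((2 * q2) *: clric d dV g c h v
      + (1 - q2) *: \sum_i \sum_j Rc i j *: (w j *: g i v))
   + (Sc * (q1 * q2)) *: (Dir v + m *: G v)).
Proof.
have E : clm g (fun i => d i Sc) (f *: v) = f *: clm g (fun i => d i Sc) v.
  rewrite scaler_sumr; apply: eq_bigr => i _.
  by rewrite (fa_gZ fa) !scalerA mulrC.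
rewrite /L1a !gauge_dir gauge_clric E /=.
by module_coefs A V; ring.
Qed.

Lemma conf_L1 v : L1a d' dV' g c' h q1 q2 v =
  (u * u * u * fi) *: L1a d dV g c h q1 q2 (f *: v).
Proof.
have dm i : d i m = 0.
  rewrite /m (fa_dM fa) (frame_dinv fa i h2) mul0r add0r.
  by rewrite (frame_dB fa) !(frame_dnat fa) subrr mulr0.
have dm1 i : d i (m + 1) = 0 by rewrite (fa_dD fa) dm (frame_d1 fa) addr0.
have NE : N = 2 * m + 3 by rewrite /m mulrA h2; ring.
(* Since (n - 1) - (n - 2) = 1. Once n is eliminated in favour of m, this is the only relation
   passed to the final [ring], where m is an opaque atom. *)
have q12 : q1 * q2 = q2 - q1.
  transitivity (q1 * q2 - q2 * (q1 * (N - 1) - 1) + q1 * (q2 * (N - 2) - 1)).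
    by rewrite q1E q2E !subrr !mulr0 subr0 addr0.
  by ring.
have clricE : (2 * q2) *: clric d' dV' g c' h v = (u * u * u) *:
  ((2 * q2) *: clric d dV g c h v + (q2 * Sc) *: G v
   - q2 *: \sum_i \sum_j Rc i j *: (w j *: g i v)
   - (2 *: \sum_i \sum_j Hs i j *: g i (Nab j v) + t *: G v
      - \sum_i \sum_j Hs i j *: (w j *: g i v))
   + 2 *: G (nabw dV g c h w v)
   - (q2 * t + b) *: (2 *: Dir v + (N - 1) *: G v)).
  rewrite conf_clric.
  transitivity ((u * u * u) *:
    ((2 * q2) *: clric d dV g c h v + (2 * h * q2 * Sc) *: G v
     - (2 * h * q2) *: \sum_i \sum_j Rc i j *: (w j *: g i v)
     - (q2 * (N - 2)) *: (2 *: \sum_i \sum_j Hs i j *: g i (Nab j v)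
        + (2 * h * t) *: G v
        - (2 * h) *: \sum_i \sum_j Hs i j *: (w j *: g i v))
     + (q2 * (N - 2) * 2) *: G (nabw dV g c h w v)
     - (q2 * t + q2 * (N - 2) * b) *: (2 *: Dir v + (2 * h * (N - 1)) *: G v))).
    by module_coefs A V; ring.
  by rewrite q2E h2 !mul1r !scale1r.
rewrite gauge_L1 /L1a conf_dir3 conf_clm_scalar clricE conf_scalar_dir [RHS]scalerA.
rewrite -(mulrA (u * u * u)) ffi mulr1; cbv zeta.
rewrite !dir_cube // NE; clearbody m.
by module_coefs A V; ring: q12.
Qed.

End Conformal.

(** * Smooth functions on an open set *)

Section SmoothTheory.
Variables (R : realType) (m : nat).
Implicit Types (U : set 'rV[R]_m) (f g : 'rV[R]_m -> R).

(** The difference g - f vanishes near x, so it has the zero map as differential there, and g is f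
    plus this difference. *)
Lemma near_eq_differentiable (V W : normedModType R) (f g : V -> W) (x : V) :
  (\near x, f x = g x) -> differentiable f x -> differentiable g x.
Proof.
move=> fg df.
have k0 : (g - f) \o shift x = cst ((g - f) x) + (0 : V -> W) +o_ 0 id.
  apply/eqaddoP => e e0; have fgx := nbhs_singleton fg.
  move: fg; rewrite (near_shift 0) subr0 => fg; near=> y.
  have fgy : f (y + x) = g (y + x) by near: y.
  rewrite [X in `|X|](_ : _ = 0) ?normr0 ?mulr_ge0 ?normr_ge0 ?(ltW e0) //.
  change (g (y + x) - f (y + x) - (g x - f x + 0) = 0).
  by rewrite fgx fgy !subrr addr0 subr0.
have kD : differentiable (g - f) x.
  apply/diff_locallyP; rewrite (diff_unique _ k0); last exact: cst_continuous.
  by split; [exact: cst_continuous | exact: k0].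
by rewrite -[g](subrK f); apply: differentiableD.
Unshelve. all: by end_near. Qed.

(** Near a point of the open set U the two functions coincide, so their derivatives do too; this
    permits passing to any convenient extension outside U. *)
Lemma Ck_on_eq k U f g : open U -> (forall y, U y -> f y = g y) ->
  Ck_on k U f -> Ck_on k U g.
Proof.
move=> oU; elim: k f g => [|k IH] f g fg /=.
  move=> cf y Uy; have fgy : \near y, f y = g y.
    by near=> z; apply: fg; near: z; exact: open_nbhs_nbhs.
  rewrite /prop_for /continuous_at -(fg y Uy).
  exact: (cvg_trans (near_eq_cvg fgy) (cf y Uy)).
have fgn y : U y -> \near y, f y = g y.
  by move=> Uy; near=> z; apply: fg; near: z; exact: open_nbhs_nbhs.
move=> [df Df]; split=> [y Uy|v].
  by apply: near_eq_differentiable (df _ Uy); exact: fgn.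
apply: IH (Df v) => y Uy; exact/near_eq_derive/fgn.
Unshelve. all: by end_near. Qed.

Lemma Ck_onS k U f : Ck_on k.+1 U f -> Ck_on k U f.
Proof.
elim: k f => [|k IH] f [df Df].
  by move=> y Uy; apply: differentiable_continuous; exact: df.
by split=> // v; apply: IH (Df v).
Qed.

Lemma Ck_on_cst k U c : Ck_on k U (cst c).
Proof.
elim: k c => [|k IH] c /=; first by move=> y _; exact: cst_continuous.
split=> [y _|v]; first exact: differentiable_cst.
by rewrite (_ : (fun y => _) = cst 0); [exact: IH | apply/funext => y; rewrite derive_cst].
Qed.

Lemma Ck_onD k U f g : open U -> Ck_on k U f -> Ck_on k U g ->
  Ck_on k U (fun y => f y + g y).
Proof.
move=> oU; elim: k f g => [|k IH] f g /=.
  by move=> cf cg y Uy; apply: continuousD; [exact: cf | exact: cg].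
move=> [df Df] [dg Dg]; split=> [y Uy|v].
  by apply: differentiableD; [exact: df | exact: dg].
apply: Ck_on_eq (IH _ _ (Df v) (Dg v)) => // y Uy.
by rewrite deriveD //; apply: diff_derivable; [exact: df | exact: dg].
Qed.

Lemma Ck_onM k U f g : open U -> Ck_on k U f -> Ck_on k U g ->
  Ck_on k U (fun y => f y * g y).
Proof.
move=> oU; elim: k f g => [|k IH] f g.
  by move=> cf cg y Uy; apply: continuousM; [exact: cf | exact: cg].
move=> Cf Cg; have [df Df] := Cf; have [dg Dg] := Cg; split=> [y Uy|v].
  by apply: differentiableM; [exact: df | exact: dg].
have CfS := Ck_onS Cf; have CgS := Ck_onS Cg.
apply: Ck_on_eq (Ck_onD oU (IH _ _ CfS (Dg v)) (IH _ _ CgS (Df v))) => // y Uy.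
by rewrite deriveM //; apply: diff_derivable; [exact: df | exact: dg].
Qed.

Lemma derive_expR_comp f (y v : 'rV[R]_m) : differentiable f y ->
  differentiable (expR \o f) y /\
  'D_v (expR \o f) y = expR (f y) * 'D_v f y.
Proof.
move=> df; have de : differentiable expR (f y).
  exact/derivable1_diffP/derivable_expR.
have dc : differentiable (expR \o f) y by exact: differentiable_comp.
split=> //; rewrite deriveE // diff_comp // deriveE //=.
by rewrite deriv1E ?derivable_expR // derive1E derive_val mulrC.
Qed.

Lemma Ck_on_expR k U f : open U -> Ck_on k U f ->
  Ck_on k U (fun y => expR (f y)).
Proof.
move=> oU; elim: k f => [|k IH] f.
  move=> cf y Uy; apply: (@continuous_comp _ _ _ f expR); first exact: cf.
  exact: continuous_expR.
move=> Cf; have [df Df] := Cf; split=> [y Uy|v].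
  by have [] := derive_expR_comp 0 (df _ Uy).
apply: Ck_on_eq (Ck_onM oU (IH _ (Ck_onS Cf)) (Df v)) => // y Uy.
by have [_ <-] := derive_expR_comp v (df _ Uy).
Qed.

Lemma Ck_on_coord k U i : Ck_on k U (fun y => y 0 i).
Proof.
case: k => [|k]; first by move=> y _; exact: coord_continuous.
split=> [y _|v]; first exact: differentiable_coord.
have -> : (fun y => 'D_v (fun x : 'rV[R]_m => x 0 i) y) = cst (v 0 i).
  apply/funext => y.
  have /matrixP/(_ 0 i) := derive_id y v.
  rewrite derive_mx; first by rewrite mxE.
  exact: derivable_id.
exact: Ck_on_cst.
Qed.

(** * Symmetry of second derivatives *)

Lemma is_derive_line f (v z : 'rV[R]_m) s : differentiable f (s *: v + z) ->
  is_derive s 1 (fun s : R => f (s *: v + z)) ('D_v f (s *: v + z)).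
Proof.
move=> df.
have E : (fun h : R => h^-1 *: (((fun s : R => f (s *: v + z)) \o shift s) (h *: 1)
      - f (s *: v + z))) =
    (fun h : R => h^-1 *: ((f \o shift (s *: v + z)) (h *: v) - f (s *: v + z))).
  apply/funext => h /=; congr (_ *: (f _ - _)).
  by rewrite scalerDl addrA -[h *: 1]/(h * 1) mulr1.
apply: DeriveDef; last by rewrite /derive E.
by rewrite /derivable E; exact: diff_derivable.
Qed.

Lemma line_mvt f (v z : 'rV[R]_m) t : 0 < t ->
  (forall s, 0 <= s <= t -> differentiable f (s *: v + z)) ->
  exists2 s, 0 <= s <= t & f (t *: v + z) - f z = 'D_v f (s *: v + z) * t.
Proof.
move=> t0 df; have [||s] := @MVT R (fun s => f (s *: v + z))
    (fun s => 'D_v f (s *: v + z)) 0 t t0.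
- move=> s; rewrite in_itv /= => /andP[s0 st].
  by apply: is_derive_line; apply: df; rewrite !ltW.
- apply: derivable_within_continuous => s; rewrite in_itv /= => st.
  by have [] := is_derive_line (df _ st).
rewrite in_itv /= => /andP[s0 st]; rewrite scale0r add0r subr0 => E.
by exists s; rewrite ?E // !ltW.
Qed.

(** Two uses of the mean value theorem: along v for $F(z) = f(z + tw) - f(z)$, then along w for the
    derivative of f in direction v. *)
Lemma second_difference U f (y v w : 'rV[R]_m) t : Ck_on 2 U f -> 0 < t ->
  (forall s r, 0 <= s <= t -> 0 <= r <= t -> U (r *: w + (s *: v + y))) ->
  exists s r, [/\ 0 <= s <= t, 0 <= r <= t &
    f (t *: v + (t *: w + y)) - f (t *: w + y) - (f (t *: v + y) - f y) =
    'D_w ('D_v f) (r *: w + (s *: v + y)) * (t * t)].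
Proof.
move=> [df Df] t0 inU.
pose F z := f (z + t *: w) - f z.
have t00 : 0 <= (0 : R) <= t by rewrite lexx ltW.
have tt : 0 <= t <= t by rewrite lexx ltW.
have U0 s : 0 <= s <= t -> U (s *: v + y).
  by move=> st; have := inU s 0 st t00; rewrite scale0r add0r.
have Ut s : 0 <= s <= t -> U (s *: v + y + t *: w).
  by move=> st; rewrite addrC; exact: inU.
have dsh z : differentiable f (z + t *: w) ->
    differentiable (fun z => f (z + t *: w)) z /\
    'D_v (fun z => f (z + t *: w)) z = 'D_v f (z + t *: w).
  move=> dfz; split; last first.
    have shE : (fun h : R => h^-1 *: (((fun z => f (z + t *: w)) \o shift z) (h *: v)
          - f (z + t *: w))) =
        (fun h => h^-1 *: ((f \o shift (z + t *: w)) (h *: v) - f (z + t *: w))).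
      by apply/funext => h /=; rewrite addrA.
    by rewrite /derive shE.
  have ds : differentiable (fun z : 'rV[R]_m => z + t *: w) z.
    by apply: differentiableD; [exact: ex_diff | exact: differentiable_cst].
  exact: (differentiable_comp ds dfz).
have [|s st E] := @line_mvt F v y t t0.
  move=> s st; apply: differentiableB; last exact/df/U0.
  by apply: (dsh _ _).1; apply/df/Ut.
have [|r rt E'] := @line_mvt ('D_v f) w (s *: v + y) t t0.
  by move=> r rt; apply: (Df v).1; exact: inU.
exists s, r; split=> //.
have -> : f (t *: v + (t *: w + y)) - f (t *: w + y) - (f (t *: v + y) - f y) =
    F (t *: v + y) - F y.
  by rewrite /F [t *: w + y]addrC addrA; ring.
have dB : 'D_v F (s *: v + y) = 'D_v f (t *: w + (s *: v + y)) - 'D_v f (s *: v + y).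
  have [d1 D1] := dsh _ (df _ (Ut _ st)).
  rewrite deriveB ?D1 ?[t *: w + _]addrC //; apply: diff_derivable => //.
  exact/df/U0.
by rewrite E dB E' mulrA.
Qed.

(** Stands for the limit t to 0 in Schwarz's theorem: the intermediate points depend on the radius
    and need not be chosen as a sequence. *)
Lemma eq_of_ball_values (A B : 'rV[R]_m -> R) (y : 'rV[R]_m) :
  {for y, continuous A} -> {for y, continuous B} ->
  (forall r, 0 < r -> exists p q, [/\ ball y r p, ball y r q & A p = B q]) ->
  A y = B y.
Proof.
move=> cA cB AB; apply/eqP; rewrite -subr_eq0 -normr_le0.
apply/ler_addgt0Pl => e e0; rewrite addr0.
have e2 : 0 < e / 2 by rewrite divr_gt0.
have nA : \forall z \near y, `|A y - A z| < e / 2.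
  by move/cvgrPdist_lt : cA => /(_ _ e2).
have nB : \forall z \near y, `|B y - B z| < e / 2.
  by move/cvgrPdist_lt : cB => /(_ _ e2).
have /nbhs_ballP [r /= r0 ball_r] : \forall z \near y,
    `|A y - A z| < e / 2 /\ `|B y - B z| < e / 2.
  exact: filterI nA nB.
have [p [q [yp yq pq]]] := AB r r0.
have [hA _] := ball_r _ yp; have [_ hB] := ball_r _ yq.
rewrite -(subrKA (B q)) -{1}pq.
rewrite (le_trans (ler_normD _ _)) // [leRHS](splitr e) lerD ?ltW //.
by rewrite distrC.
Qed.

(** The second difference is symmetric in v and w, so it computes both mixed derivatives, at two
    points that tend to y. *)
Lemma derive_comm U f (y v w : 'rV[R]_m) : open U -> Ck_on 2 U f -> U y ->
  'D_w ('D_v f) y = 'D_v ('D_w f) y.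
Proof.
move=> oU Cf Uy; have [_ Df] := Cf.
have cA := (Df v).2 w y Uy; have cB := (Df w).2 v y Uy.
apply: (eq_of_ball_values cA cB) => r0' r0'0.
have /nbhs_ballP [r1 /= r10 ball_r] : nbhs y U by exact: open_nbhs_nbhs.
pose r := Num.min r0' r1; have r0 : 0 < r by rewrite lt_min r0'0.
(* Keeps the parallelogram spanned by t v and t w at y inside the ball of radius r: the half makes
   the bound strict, and the 1 keeps the denominator positive when v = w = 0. *)
pose t := r / 2 / (`|v| + `|w| + 1).
have den0 : 0 < `|v| + `|w| + 1 by rewrite ltr_wpDl // addr_ge0.
have t0 : 0 < t by rewrite !divr_gt0.
have inball a b s s' : 0 <= s <= t -> 0 <= s' <= t -> a + b = `|v| + `|w| ->
    forall x z : 'rV[R]_m, `|x| = a -> `|z| = b ->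
    ball y r (s' *: x + (s *: z + y)).
  move=> /andP[s0 st] /andP[s0' st'] ab x z xa zb.
  rewrite -ball_normE /= [X in `|X|](_ : _ = - (s' *: x + s *: z)); last first.
    by rewrite addrA opprD addrCA subrr addr0.
  rewrite normrN.
  rewrite (le_lt_trans (ler_normD _ _)) // !normrZ !ger0_norm // xa zb.
  have : t * (`|v| + `|w| + 1) < r.
    by rewrite mulfVK ?gt_eqF // ltr_pdivrMr // ltr_pMr // ltr1n.
  apply: le_lt_trans; rewrite -ab mulrDr mulr1 mulrDr -[leLHS]addr0.
  rewrite lerD ?(ltW t0) // lerD // ler_wpM2r // -?xa -?zb //.
have inU a b x z : a + b = `|v| + `|w| -> `|x| = a -> `|z| = b ->
    forall s s', 0 <= s <= t -> 0 <= s' <= t -> U (s' *: x + (s *: z + y)).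
  move=> ab xa zb s s' st st'; apply: ball_r.
  have := inball a b s s' st st' ab x z xa zb.
  by apply: le_ball; rewrite ge_min lexx orbT.
have [s [s' [st st' E]]] := second_difference Cf t0
  (inU _ _ w v (addrC _ _) erefl erefl).
have [q [q' [qt qt' E']]] := second_difference Cf t0
  (inU _ _ v w erefl erefl erefl).
have ler : r <= r0' by rewrite ge_min lexx.
have B1 := le_ball ler (inball _ _ s s' st st' (addrC _ _) w v erefl erefl).
have B2 := le_ball ler (inball _ _ q q' qt qt' erefl v w erefl erefl).
exists (s' *: w + (s *: v + y)), (q' *: v + (q *: w + y)); split.
- exact: B1.
- exact: B2.
have tt : t * t != 0 by rewrite mulf_neq0 ?gt_eqF.
by apply: (mulIf tt); rewrite -[LHS]E -[RHS]E' addrCA; ring.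
Qed.

End SmoothTheory.

Section CinfTheory.
Variables (R : realType) (m : nat).
Implicit Types (U : set 'rV[R]_m) (f g : 'rV[R]_m -> R).

Lemma Cinf_on_eq U f g : open U -> (forall y, U y -> f y = g y) ->
  Cinf_on U f -> Cinf_on U g.
Proof. by move=> oU fg Cf k; apply: Ck_on_eq (Cf k). Qed.

Lemma Cinf_on_cst U c : Cinf_on U (fun=> c).
Proof. by move=> k; exact: Ck_on_cst. Qed.

Lemma Cinf_onD U f g : open U -> Cinf_on U f -> Cinf_on U g ->
  Cinf_on U (fun y => f y + g y).
Proof. by move=> oU Cf Cg k; apply: Ck_onD. Qed.

Lemma Cinf_onM U f g : open U -> Cinf_on U f -> Cinf_on U g ->
  Cinf_on U (fun y => f y * g y).
Proof. by move=> oU Cf Cg k; apply: Ck_onM. Qed.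

Lemma Cinf_onN U f : open U -> Cinf_on U f -> Cinf_on U (fun y => - f y).
Proof.
move=> oU Cf; have := Cinf_onM oU (Cinf_on_cst U (-1)) Cf.
by apply: Cinf_on_eq => // y _; rewrite mulN1r.
Qed.

Lemma Cinf_onB U f g : open U -> Cinf_on U f -> Cinf_on U g ->
  Cinf_on U (fun y => f y - g y).
Proof. by move=> oU Cf Cg; apply: Cinf_onD => //; exact: Cinf_onN. Qed.

Lemma Cinf_on_sum U (I : Type) (r : seq I) (P : pred I) (F : I -> 'rV[R]_m -> R) :
  open U -> (forall i, Cinf_on U (F i)) ->
  Cinf_on U (fun y => \sum_(i <- r | P i) F i y).
Proof.
move=> oU CF; elim: r => [|i r IH].
  by apply: Cinf_on_eq (Cinf_on_cst U 0) => // y _; rewrite big_nil.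
case Pi: (P i).
  by apply: Cinf_on_eq (Cinf_onD oU (CF i) IH) => // y _; rewrite big_cons Pi.
by apply: Cinf_on_eq IH => // y _; rewrite big_cons Pi.
Qed.

Lemma Cinf_on_expR U f : open U -> Cinf_on U f ->
  Cinf_on U (fun y => expR (f y)).
Proof. by move=> oU Cf k; apply: Ck_on_expR. Qed.

Lemma Cinf_on_coord U i : Cinf_on U (fun y => y 0 i).
Proof. by move=> k; exact: Ck_on_coord. Qed.

Lemma Cinf_on_derive U f v : Cinf_on U f -> Cinf_on U ('D_v f).
Proof. by move=> Cf k; exact: (Cf k.+1).2. Qed.

Lemma Cinf_on_diff U f y : Cinf_on U f -> U y -> differentiable f y.
Proof. by move=> Cf; exact: (Cf 1%N).1. Qed.

End CinfTheory.

(** Openness is bundled with the set because the ring and module structures built on it depend on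
    it. *)
Record open_dom (R : realType) (m : nat) := OpenDom {
  odom :> set 'rV[R]_m;
  odom_open : open odom }.

Section SmoothFunctions.
Variables (R : realType) (m : nat) (D : open_dom R m).

(* Derivatives are only defined for functions on the whole of R^m, hence the
   extension by zero. *)
Definition ext0 (M : zmodType) (a : D -> M) (y : 'rV[R]_m) : M :=
  oapp a 0 (insub y).

Lemma ext0E (M : zmodType) (f : 'rV[R]_m -> M) y :
  odom D y -> ext0 (fun t : D => f (val t)) y = f y.
Proof.
move=> Dy; rewrite /ext0; case: insubP => [t _ <- //|].
by rewrite mem_set.
Qed.

Lemma ext0_val (M : zmodType) (a : D -> M) (t : D) : ext0 a (val t) = a t.
Proof. by rewrite /ext0 valK. Qed.

Definition smooth_fct : {pred (D -> R)} := fun a => `[< Cinf_on D (ext0 a) >].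

Lemma smooth_fct_subring : subring_closed smooth_fct.
Proof.
have oD := @odom_open _ _ D.
split => [|a b /asboolP Ca /asboolP Cb|a b /asboolP Ca /asboolP Cb]; apply/asboolP.
- apply: Cinf_on_eq oD _ (Cinf_on_cst (odom D) 1) => y Dy.
  by rewrite /ext0; case: insubP => //; rewrite mem_set.
- apply: Cinf_on_eq oD _ (Cinf_onB oD Ca Cb) => y _.
  by rewrite /ext0; case: insubP => //= _; rewrite subr0.
- apply: Cinf_on_eq oD _ (Cinf_onM oD Ca Cb) => y _.
  by rewrite /ext0; case: insubP => //= _; rewrite mulr0.
Qed.
HB.instance Definition _ :=
  GRing.isSubringClosed.Build (D -> R) smooth_fct smooth_fct_subring.

(** Functions on the subtype, so that equality on the domain is equality in the ring, as the
    algebraic part demands. The domain being open, the zero extension imposes no condition at its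
    boundary. *)
Record sfun := SFun { sfun_val : D -> R; _ : sfun_val \in smooth_fct }.
HB.instance Definition _ := [isSub for sfun_val].
HB.instance Definition _ := [Choice of sfun by <:].
HB.instance Definition _ := GRing.SubChoice_isSubComPzRing.Build
  (D -> R) smooth_fct sfun smooth_fct_subring.

Definition sfn (a : sfun) : 'rV[R]_m -> R := ext0 (sfun_val a).

Lemma sfnP a : Cinf_on D (sfn a).
Proof. by apply/asboolP; case: a. Qed.

Lemma sfun_eq a b : (forall y, odom D y -> sfn a y = sfn b y) -> a = b.
Proof.
move=> ab; apply: val_inj; apply/funext => t.
have := ab (val t) (set_mem (valP t)).
by rewrite /sfn !ext0_val.
Qed.

Lemma sfnD a b y : sfn (a + b) y = sfn a y + sfn b y.
Proof. by rewrite /sfn /ext0; case: insubP => //= _; rewrite addr0. Qed.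

Lemma sfnN a y : sfn (- a) y = - sfn a y.
Proof. by rewrite /sfn /ext0; case: insubP => //= _; rewrite oppr0. Qed.

Lemma sfnB a b y : sfn (a - b) y = sfn a y - sfn b y.
Proof. by rewrite sfnD sfnN. Qed.

Lemma sfnM a b y : sfn (a * b) y = sfn a y * sfn b y.
Proof. by rewrite /sfn /ext0; case: insubP => //= _; rewrite mulr0. Qed.

Lemma sfn0 y : sfn 0 y = 0.
Proof. by rewrite /sfn /ext0; case: insubP. Qed.

Lemma sfn_sum (I : Type) (r : seq I) (P : pred I) (F : I -> sfun) y :
  sfn (\sum_(i <- r | P i) F i) y = \sum_(i <- r | P i) sfn (F i) y.
Proof. exact: (big_morph (sfn^~ y) (fun a b => sfnD a b y) (sfn0 y)). Qed.

Lemma smooth_fct_res f : Cinf_on D f -> (f \o val : D -> R) \in smooth_fct.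
Proof.
move=> Cf; apply/asboolP; apply: Cinf_on_eq (@odom_open _ _ D) _ Cf => y Dy.
by rewrite ext0E.
Qed.

Definition mk_sfun f (Cf : Cinf_on D f) : sfun := SFun (smooth_fct_res Cf).

Lemma mk_sfunE f (Cf : Cinf_on D f) y : odom D y -> sfn (mk_sfun Cf) y = f y.
Proof. exact: ext0E. Qed.

Lemma sfn1 y : odom D y -> sfn 1 y = 1.
Proof. by move=> Dy; rewrite /sfn /ext0; case: insubP => //; rewrite mem_set. Qed.

Lemma sfn_nat k y : odom D y -> sfn k%:R y = k%:R.
Proof.
move=> Dy; elim: k => [|k IH]; first exact: sfn0.
by rewrite -addn1 !natrD sfnD IH sfn1.
Qed.

Variable N : nat.
Local Notation spin := ('rV[R]_m -> 'cV[R[i]]_N).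

Definition Cinf_spin (psi : spin) : Prop := forall k,
  Cinf_on D (fun y => complex.Re (psi y k 0)) /\
  Cinf_on D (fun y => complex.Im (psi y k 0)).

Lemma Cinf_spin_eq (psi phi : spin) :
  (forall y, odom D y -> psi y = phi y) -> Cinf_spin psi -> Cinf_spin phi.
Proof.
move=> pp Cpsi k; split; [have := (Cpsi k).1 | have := (Cpsi k).2];
  by apply: Cinf_on_eq (@odom_open _ _ D) _ => y Dy; rewrite pp.
Qed.

Lemma Cinf_spinB (psi phi : spin) :
  Cinf_spin psi -> Cinf_spin phi -> Cinf_spin (fun y => psi y - phi y).
Proof.
move=> Cpsi Cphi k; have [r1 i1] := Cpsi k; have [r2 i2] := Cphi k.
have oD := @odom_open _ _ D.
split; [move: (Cinf_onB oD r1 r2) | move: (Cinf_onB oD i1 i2)];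
  apply: Cinf_on_eq oD _ => y Dy; rewrite !mxE;
  by case: (psi y k 0) (phi y k 0) => [? ?] [].
Qed.

Lemma Cinf_spinZ f (psi : spin) :
  Cinf_on D f -> Cinf_spin psi -> Cinf_spin (fun y => (f y)%:C%C *: psi y).
Proof.
move=> Cf Cpsi k; have [r1 i1] := Cpsi k; have oD := @odom_open _ _ D.
split; [move: (Cinf_onM oD Cf r1) | move: (Cinf_onM oD Cf i1)];
  apply: Cinf_on_eq oD _ => y Dy; rewrite !mxE;
  by case: (psi y k 0) => ? ? /=; ring.
Qed.

Lemma ReM (x y : R[i]) :
  complex.Re (x * y) = complex.Re x * complex.Re y - complex.Im x * complex.Im y.
Proof. by case: x y => ? ? []. Qed.

Lemma ImM (x y : R[i]) :
  complex.Im (x * y) = complex.Re x * complex.Im y + complex.Im x * complex.Re y.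
Proof. by case: x y => ? ? []. Qed.

Lemma Re_sum (I : Type) (r : seq I) (P : pred I) (F : I -> R[i]) :
  complex.Re (\sum_(i <- r | P i) F i) = \sum_(i <- r | P i) complex.Re (F i).
Proof.
have DRe : {morph @complex.Re R : x y / x + y} by move=> [? ?] [].
exact: (big_morph _ DRe erefl).
Qed.

Lemma Im_sum (I : Type) (r : seq I) (P : pred I) (F : I -> R[i]) :
  complex.Im (\sum_(i <- r | P i) F i) = \sum_(i <- r | P i) complex.Im (F i).
Proof.
have DIm : {morph @complex.Im R : x y / x + y} by move=> [? ?] [].
exact: (big_morph _ DIm erefl).
Qed.

Lemma Cinf_spin_mul (A : 'M[R[i]]_N) (psi : spin) :
  Cinf_spin psi -> Cinf_spin (fun y => A *m psi y).
Proof.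
move=> Cpsi k; have oD := @odom_open _ _ D; split.
  apply: (Cinf_on_eq oD (f := fun y => \sum_l (complex.Re (A k l) *
    complex.Re (psi y l 0) - complex.Im (A k l) * complex.Im (psi y l 0)))).
    by move=> y _; rewrite mxE Re_sum; apply: eq_bigr => l _; rewrite ReM.
  apply: Cinf_on_sum => // l; have [r1 i1] := Cpsi l.
  by apply: Cinf_onB => //; apply: Cinf_onM => //; exact: Cinf_on_cst.
apply: (Cinf_on_eq oD (f := fun y => \sum_l (complex.Re (A k l) *
  complex.Im (psi y l 0) + complex.Im (A k l) * complex.Re (psi y l 0)))).
  by move=> y _; rewrite mxE Im_sum; apply: eq_bigr => l _; rewrite ImM.
apply: Cinf_on_sum => // l; have [r1 i1] := Cpsi l.
by apply: Cinf_onD => //; apply: Cinf_onM => //; exact: Cinf_on_cst.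
Qed.

Definition smooth_sspin : {pred (D -> 'cV[R[i]]_N)} :=
  fun v => `[< Cinf_spin (ext0 v) >].

Lemma smooth_sspin_zmod : zmod_closed smooth_sspin.
Proof.
split => [|u v /asboolP Cu /asboolP Cv]; apply/asboolP.
  move=> k; split; apply: Cinf_on_eq (@odom_open _ _ D) _ (Cinf_on_cst (odom D) 0) => y _;
    by rewrite /ext0; case: insubP => [? _ _|_] /=; rewrite mxE.
apply: Cinf_spin_eq (Cinf_spinB Cu Cv) => y _.
by rewrite /ext0; case: insubP => //= _; rewrite subr0.
Qed.
HB.instance Definition _ :=
  GRing.isZmodClosed.Build (D -> 'cV[R[i]]_N) smooth_sspin smooth_sspin_zmod.

Record sspin := SSpin { sspin_val : D -> 'cV[R[i]]_N; _ : sspin_val \in smooth_sspin }.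
HB.instance Definition _ := [isSub for sspin_val].
HB.instance Definition _ := [Choice of sspin by <:].
HB.instance Definition _ := [SubChoice_isSubZmodule of sspin by <:].

Definition ssp (v : sspin) : spin := ext0 (sspin_val v).

Lemma sspP v : Cinf_spin (ssp v).
Proof. by apply/asboolP; case: v. Qed.

Lemma sspin_eq v w : (forall y, odom D y -> ssp v y = ssp w y) -> v = w.
Proof.
move=> vw; apply: val_inj; apply/funext => t.
have := vw (val t) (set_mem (valP t)).
by rewrite /ssp !ext0_val.
Qed.

Lemma smooth_sspin_res psi : Cinf_spin psi -> (psi \o val : D -> 'cV[R[i]]_N) \in smooth_sspin.
Proof.
move=> Cf; apply/asboolP; apply: Cinf_spin_eq Cf => y Dy.
by rewrite ext0E.
Qed.

Definition mk_sspin psi (Cpsi : Cinf_spin psi) : sspin := SSpin (smooth_sspin_res Cpsi).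

Lemma mk_sspinE psi (Cpsi : Cinf_spin psi) y : odom D y -> ssp (mk_sspin Cpsi) y = psi y.
Proof. exact: ext0E. Qed.

Lemma sspD v w y : ssp (v + w) y = ssp v y + ssp w y.
Proof. by rewrite /ssp /ext0; case: insubP => //= _; rewrite addr0. Qed.

Lemma sspN v y : ssp (- v) y = - ssp v y.
Proof. by rewrite /ssp /ext0; case: insubP => //= _; rewrite oppr0. Qed.

Lemma ssp0 y : ssp 0 y = 0.
Proof. by rewrite /ssp /ext0; case: insubP. Qed.

Lemma ssp_sum (I : Type) (r : seq I) (P : pred I) (F : I -> sspin) y :
  ssp (\sum_(i <- r | P i) F i) y = \sum_(i <- r | P i) ssp (F i) y.
Proof. exact: (big_morph (ssp^~ y) (fun a b => sspD a b y) (ssp0 y)). Qed.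

Definition sspin_scale (a : sfun) (v : sspin) : sspin :=
  mk_sspin (Cinf_spinZ (sfnP a) (sspP v)).

Lemma sspin_scaleE a v y : odom D y ->
  ssp (sspin_scale a v) y = (sfn a y)%:C%C *: ssp v y.
Proof. exact: mk_sspinE. Qed.

Let scaleA a b v : sspin_scale a (sspin_scale b v) = sspin_scale (a * b) v.
Proof.
apply: sspin_eq => y Dy; rewrite !sspin_scaleE // scalerA sfnM.
by rewrite rmorphM.
Qed.

Let scale1 : left_id 1 sspin_scale.
Proof. by move=> v; apply: sspin_eq => y Dy; rewrite sspin_scaleE // sfn1 // scale1r. Qed.

Let scaleDr : right_distributive sspin_scale +%R.
Proof.
by move=> a v w; apply: sspin_eq => y Dy; rewrite sspD !sspin_scaleE // sspD scalerDr.
Qed.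

Let scaleDl v : {morph sspin_scale^~ v : a b / a + b}.
Proof.
move=> a b; apply: sspin_eq => y Dy; rewrite sspD !sspin_scaleE // sfnD.
by rewrite rmorphD scalerDl.
Qed.

HB.instance Definition _ :=
  GRing.Zmodule_isLmodule.Build sfun sspin scaleA scale1 scaleDr scaleDl.

Lemma sspZ (a : sfun) (v : sspin) y : odom D y -> ssp (a *: v) y = (sfn a y)%:C%C *: ssp v y.
Proof. exact: sspin_scaleE. Qed.

End SmoothFunctions.

(** * The frame calculus of a local trivialisation *)

Section DirectionalDerivative.
Variables (R : realType) (m : nat).
Implicit Types (f g : 'rV[R]_m -> R) (y v : 'rV[R]_m).

Lemma derive_dir_sum (I : Type) (r : seq I) (P : pred I) (a : I -> R)
    (v : I -> 'rV[R]_m) f y : differentiable f y ->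
  'D_(\sum_(i <- r | P i) a i *: v i) f y = \sum_(i <- r | P i) a i * 'D_(v i) f y.
Proof.
move=> df; rewrite deriveE // linear_sum; apply: eq_bigr => i _.
by rewrite linearZ deriveE.
Qed.

(** [Ck_on] controls derivatives in constant directions; this reduces differentiation along a
    variable field to those. *)
Lemma derive_dir_coord f y v : differentiable f y ->
  'D_v f y = \sum_l v 0 l * 'D_(delta_mx 0 l) f y.
Proof. by move=> df; rewrite {1}[v]row_sum_delta derive_dir_sum. Qed.

Lemma derive_eq_on (U : set 'rV[R]_m) f g y v : open U -> U y ->
  (forall z, U z -> f z = g z) -> 'D_v f y = 'D_v g y.
Proof.
move=> oU Uy fg; apply: near_eq_derive.
have : \forall z \near y, U z by exact: open_nbhs_nbhs.
by apply: filterS => z /fg.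
Qed.

Lemma derive_coord (Y : 'rV[R]_m -> 'rV[R]_m) y v l :
  (forall l, differentiable (fun z => Y z 0 l) y) ->
  ('D_v Y y) 0 l = 'D_v (fun z => Y z 0 l) y.
Proof.
move=> dY; rewrite derive_mx ?mxE //; apply/derivable_mxP => i j.
by rewrite (ord1 i); apply: diff_derivable.
Qed.

Lemma derive_sumM (I : Type) (r : seq I) (F G : I -> 'rV[R]_m -> R) y v :
  (forall i, differentiable (F i) y) -> (forall i, differentiable (G i) y) ->
  differentiable (fun z => \sum_(i <- r) F i z * G i z) y /\
  'D_v (fun z => \sum_(i <- r) F i z * G i z) y =
    \sum_(i <- r) ('D_v (F i) y * G i y + F i y * 'D_v (G i) y).
Proof.
move=> dF dG; elim: r => [|i r [dS IH]].
  rewrite big_nil (_ : (fun z => _) = cst 0); last by apply/funext => z; rewrite big_nil.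
  by split; [exact: differentiable_cst | exact: derive_cst].
have dFG : differentiable (F i * G i) y by exact: differentiableM.
rewrite (_ : (fun z => _) = F i * G i + (fun z => \sum_(i <- r) F i z * G i z)).
  split; first exact: differentiableD.
  rewrite deriveD; try exact: diff_derivable.
  rewrite deriveM; try exact: diff_derivable.
  rewrite big_cons IH; congr (_ + _).
  by rewrite addrC; congr (_ + _); rewrite -[LHS]/(_ * _) mulrC.
by apply/funext => z; rewrite big_cons.
Qed.

Lemma derive_lincomb (I : Type) (r : seq I) (a : I -> R)
    (F : I -> 'rV[R]_m -> R) y v : (forall i, differentiable (F i) y) ->
  'D_v (fun z => \sum_(i <- r) a i * F i z) y = \sum_(i <- r) a i * 'D_v (F i) y.
Proof.
move=> dF; have dc i : differentiable (cst (a i) : 'rV[R]_m -> R) y.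
  exact: differentiable_cst.
have [_ ->] := derive_sumM r v dc dF.
by apply: eq_bigr => i _; rewrite derive_cst mul0r add0r.
Qed.

End DirectionalDerivative.

Section ComplexParts.
Variable R : realType.

Definition cpart (b : bool) (z : R[i]) : R :=
  if b then complex.Im z else complex.Re z.

(** This is [cpart b] of i z, the companion term in the product rule [cpartM]. Indexing by a boolean
    lets one argument cover the real and the imaginary part. *)
Definition cpart_im (b : bool) (z : R[i]) : R :=
  if b then complex.Re z else - complex.Im z.

Lemma cpart_eq (z w : R[i]) : (forall b, cpart b z = cpart b w) -> z = w.
Proof.
case: z w => [x y] [x' y'] zw.
by have /= -> := zw false; have /= -> := zw true.
Qed.

Lemma cpartD b z w : cpart b (z + w) = cpart b z + cpart b w.
Proof. by case: b z w => -[? ?] []. Qed.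

Lemma cpart_sum b (I : Type) (r : seq I) (P : pred I) (F : I -> R[i]) :
  cpart b (\sum_(i <- r | P i) F i) = \sum_(i <- r | P i) cpart b (F i).
Proof.
have c0 : cpart b 0 = 0 by case: b.
exact: (big_morph (cpart b) (cpartD b) c0).
Qed.

Lemma cpartM b z w :
  cpart b (z * w) = cpart b z * cpart false w + cpart_im b z * cpart true w.
Proof. by case: b z w => -[a b] [c d] /=; rewrite /cpart_im /=; ring. Qed.

Lemma cpartZ b (r : R) z : cpart b (r%:C%C * z) = r * cpart b z.
Proof. by case: b z => -[c d] /=; ring. Qed.

End ComplexParts.


Section SpinorComponents.
Variables (R : realType) (n N : nat) (D : open_dom R n).
Implicit Types (v w : sspin D N).

Definition spc b k v (y : 'rV[R]_n) : R := cpart b (ssp v y k 0).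

Lemma spcD b k v w y : spc b k (v + w) y = spc b k v y + spc b k w y.
Proof. by rewrite /spc sspD mxE cpartD. Qed.

Lemma spcN b k v y : spc b k (- v) y = - spc b k v y.
Proof. by rewrite /spc sspN mxE; case: b (ssp v y k 0) => -[]. Qed.

Lemma spcB b k v w y : spc b k (v - w) y = spc b k v y - spc b k w y.
Proof. by rewrite spcD spcN. Qed.

Lemma spcZ b k a v y : odom D y -> spc b k (a *: v) y = sfn a y * spc b k v y.
Proof. by move=> Dy; rewrite /spc sspZ // mxE cpartZ. Qed.

Lemma spc_sum b k (I : Type) (r : seq I) (P : pred I) (F : I -> sspin D N) y :
  spc b k (\sum_(i <- r | P i) F i) y = \sum_(i <- r | P i) spc b k (F i) y.
Proof. by rewrite /spc ssp_sum summxE cpart_sum. Qed.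

Lemma sspin_spc v w :
  (forall y b k, odom D y -> spc b k v y = spc b k w y) -> v = w.
Proof.
move=> vw; apply: sspin_eq => y Dy; apply/colP => k.
by apply: cpart_eq => b; exact: vw.
Qed.

Lemma Cinf_cpart b (psi : 'rV[R]_n -> 'cV[R[i]]_N) k :
  Cinf_spin D psi -> Cinf_on D (fun z => cpart b (psi z k 0)).
Proof. by move=> Cpsi; case: b; have [] := Cpsi k. Qed.

Lemma Cinf_spc b k v : Cinf_on D (spc b k v).
Proof. exact: Cinf_cpart (sspP v). Qed.

End SpinorComponents.

Section Frame.
Variables (R : realType) (n N : nat) (D : open_dom R n).
Variables (h : 'rV[R]_n -> 'M[R]_n) (e : 'I_n -> 'rV[R]_n -> 'rV[R]_n).
Variable (gm : 'I_n -> 'M[R[i]]_N).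
Hypothesis hS : forall i j, Cinf_on D (fun y => h y i j).
Hypothesis eS : forall i j, Cinf_on D (fun y => e i y 0 j).
Hypothesis eON : forall i j y, odom D y ->
  (e i y *m h y *m (e j y)^T) 0 0 = (i == j)%:R.
Hypothesis gmC : forall i j,
  gm i *m gm j + gm j *m gm i = ((- 2) * (i == j)%:R)%:M.

Let oD := @odom_open _ _ D.

Definition Cinf_vf (X : 'rV[R]_n -> 'rV[R]_n) := forall l, Cinf_on D (fun y => X y 0 l).

Lemma Cinf_act X f : Cinf_vf X -> Cinf_on D f -> Cinf_on D (act X f).
Proof.
move=> CX Cf; apply: (Cinf_on_eq oD (f := fun y => \sum_l X y 0 l * 'D_(delta_mx 0 l) f y)).
  by move=> y Dy; rewrite /act [RHS]derive_dir_coord //; exact: Cinf_on_diff Cf Dy.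
apply: Cinf_on_sum => // l; apply: Cinf_onM => //; exact: Cinf_on_derive.
Qed.

Lemma Cinf_bracket X Y : Cinf_vf X -> Cinf_vf Y -> Cinf_vf (bracket X Y).
Proof.
move=> CX CY l; apply: (Cinf_on_eq oD (f := fun y =>
    act X (fun z => Y z 0 l) y - act Y (fun z => X z 0 l) y)).
  move=> y Dy; rewrite /bracket !mxE !derive_coord // => k.
    exact: Cinf_on_diff (CX k) Dy.
  exact: Cinf_on_diff (CY k) Dy.
by apply: Cinf_onB => //; exact: Cinf_act.
Qed.

Lemma Cinf_inner X Y : Cinf_vf X -> Cinf_vf Y -> Cinf_on D (inner h X Y).
Proof.
move=> CX CY; apply: (Cinf_on_eq oD (f := fun y =>
    \sum_j (\sum_i X y 0 i * h y i j) * Y y 0 j)).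
  move=> y Dy; rewrite /inner mxE; apply: eq_bigr => j _; rewrite !mxE.
  by congr (_ * _); apply: eq_bigr => i _.
apply: Cinf_on_sum => // j; apply: Cinf_onM => //.
by apply: Cinf_on_sum => // i; apply: Cinf_onM.
Qed.

(** Orthonormality says that $h E^T$ is a right inverse of the matrix E of the frame; E being
    square, it is also a left inverse. *)
Lemma frame_decomp y v : odom D y ->
  v = \sum_k (v *m h y *m (e k y)^T) 0 0 *: e k y.
Proof.
move=> Dy; pose E := \matrix_(k, l) e k y 0 l.
have rE k : row k E = e k y by apply/rowP => l; rewrite !mxE.
have EhE : E *m (h y *m E^T) = 1%:M.
  apply/matrixP => i j; rewrite mulmxA mxE [RHS]mxE -(eON i j Dy) [RHS]mxE.
  apply: eq_bigr => l _; rewrite !mxE; congr (_ * _).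
  by apply: eq_bigr => k _; rewrite !mxE.
rewrite {1}(_ : v = v *m (h y *m E^T) *m E); last first.
  by rewrite -mulmxA (mulmx1C EhE) mulmx1.
rewrite mulmx_sum_row; apply: eq_bigr => k _; rewrite rE; congr (_ *: _).
rewrite mulmxA !mxE; apply: eq_bigr => l _; rewrite !mxE; congr (_ * _).
Qed.

Definition dF i (a : sfun D) : sfun D := mk_sfun (Cinf_act (eS i) (sfnP a)).

Lemma dFE i a y : odom D y -> sfn (dF i a) y = 'D_(e i y) (sfn a) y.
Proof. exact: mk_sfunE. Qed.

Definition cF i j k : sfun D :=
  mk_sfun (Cinf_inner (Cinf_bracket (eS i) (eS j)) (eS k)).

Lemma bracket_cF i j y : odom D y ->
  bracket (e i) (e j) y = \sum_p sfn (cF i j p) y *: e p y.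
Proof.
move=> Dy; rewrite [LHS](frame_decomp _ Dy); apply: eq_bigr => p _.
by rewrite mk_sfunE.
Qed.

(** In coordinates the second-order parts of the two compositions agree by [derive_comm]; the
    first-order parts add up to the derivative along the bracket. *)
Lemma act_comm f i j y : odom D y -> Cinf_on D f ->
  act (e i) (act (e j) f) y - act (e j) (act (e i) f) y =
  \sum_p sfn (cF i j p) y * 'D_(e p y) f y.
Proof.
move=> Dy Cf; have df z : odom D z -> differentiable f z by exact: Cinf_on_diff.
pose H k l := 'D_(delta_mx 0 k) ('D_(delta_mx 0 l) f) y.
have Hsym k l : H k l = H l k by exact: (derive_comm _ _ oD (Cf 2%N) Dy).
have E a b : act (e a) (act (e b) f) y =
    \sum_l ('D_(e a y) (fun z => e b z 0 l) y * 'D_(delta_mx 0 l) f y)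
    + \sum_l \sum_k (e b y 0 l * e a y 0 k) * H k l.
  rewrite /act (derive_eq_on (g := fun z => \sum_l e b z 0 l * 'D_(delta_mx 0 l) f z)
    _ oD Dy); last by move=> z Dz; rewrite -derive_dir_coord //; exact: df.
  have dl l : differentiable ('D_(delta_mx 0 l) f) y.
    by apply: Cinf_on_diff Dy; exact: Cinf_on_derive.
  have [_ ->] := derive_sumM (index_enum _) (e a y) (fun l => Cinf_on_diff (eS b l) Dy) dl.
  rewrite -big_split; apply: eq_bigr => l _ /=; congr (_ + _).
  rewrite [X in _ * X]derive_dir_coord // mulr_sumr.
  by apply: eq_bigr => k _; rewrite mulrA.
clearbody H; rewrite !E [X in _ - (_ + X)]exchange_big /=.
have -> : \sum_l \sum_k e j y 0 l * e i y 0 k * H k l =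
    \sum_l \sum_k e i y 0 k * e j y 0 l * H l k.
  by apply: eq_bigr => l _; apply: eq_bigr => k _; rewrite Hsym [_ 0 l * _]mulrC.
rewrite opprD addrACA subrr addr0 -sumrB -(derive_dir_sum _ _ _ _ (df _ Dy)) -bracket_cF //.
rewrite derive_dir_coord; last exact: df.
apply: eq_bigr => l _; rewrite -mulrBl; congr (_ * _).
by rewrite /bracket !mxE !derive_coord // => k; apply: Cinf_on_diff Dy.
Qed.

Lemma cpart_act_spin b X (psi : 'rV[R]_n -> 'cV[R[i]]_N) y k :
  cpart b (act_spin X psi y k 0) = act X (fun z => cpart b (psi z k 0)) y.
Proof. by rewrite mxE; case: b. Qed.

Lemma Cinf_act_spin X psi :
  Cinf_vf X -> Cinf_spin D psi -> Cinf_spin D (@act_spin R n N X psi).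
Proof.
move=> CX Cpsi k; split.
  apply: (Cinf_on_eq oD _ (Cinf_act CX (Cinf_cpart false k Cpsi))) => y Dy.
  by rewrite -(cpart_act_spin false).
apply: (Cinf_on_eq oD _ (Cinf_act CX (Cinf_cpart true k Cpsi))) => y Dy.
by rewrite -(cpart_act_spin true).
Qed.

Definition dVF i (v : sspin D N) : sspin D N :=
  mk_sspin (Cinf_act_spin (eS i) (sspP v)).

Definition gF i (v : sspin D N) : sspin D N := mk_sspin (Cinf_spin_mul (gm i) (sspP v)).

Lemma gFE i v y : odom D y -> ssp (gF i v) y = gm i *m ssp v y.
Proof. exact: mk_sspinE. Qed.

Lemma dVFE i v y b k : odom D y ->
  spc b k (dVF i v) y = 'D_(e i y) (spc b k v) y.
Proof. by move=> Dy; rewrite /spc mk_sspinE // cpart_act_spin. Qed.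

Lemma gF_spc i v y b k : odom D y -> spc b k (gF i v) y =
  \sum_l (cpart b (gm i k l) * spc false l v y)
  + \sum_l (cpart_im b (gm i k l) * spc true l v y).
Proof.
move=> Dy; rewrite /spc gFE // mxE cpart_sum -big_split.
by apply: eq_bigr => l _; rewrite cpartM.
Qed.

Lemma diff_sfn (a : sfun D) y : odom D y -> differentiable (sfn a) y.
Proof. exact: Cinf_on_diff (sfnP a). Qed.

Lemma diff_spc b k (v : sspin D N) y : odom D y -> differentiable (spc b k v) y.
Proof. exact: Cinf_on_diff (Cinf_spc b k v). Qed.

Lemma frame_fa : frame_axioms dF dVF gF cF.
Proof.
split.
- move=> i a b; apply: sfun_eq => y Dy; rewrite sfnD !(dFE _ _ Dy).
  rewrite (_ : sfn (a + b) = sfn a + sfn b).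
    by rewrite deriveD //; exact/diff_derivable/diff_sfn.
  by apply/funext => z; rewrite sfnD.
- move=> i a b; apply: sfun_eq => y Dy; rewrite sfnD !sfnM !(dFE _ _ Dy).
  rewrite (_ : sfn (a * b) = sfn a * sfn b).
    rewrite deriveM; try exact/diff_derivable/diff_sfn.
    by rewrite addrC; congr (_ + _); rewrite -[LHS]/(_ * _) mulrC.
  by apply/funext => z; rewrite sfnM.
- move=> i v w; apply: sspin_spc => y b k Dy.
  rewrite spcD !(dVFE _ _ _ _ Dy) -deriveD; try exact/diff_derivable/diff_spc.
  by congr ('D__ _ _); apply/funext => z; rewrite spcD.
- move=> i a v; apply: sspin_spc => y b k Dy.
  rewrite spcD !(spcZ _ _ _ _ Dy) !(dVFE _ _ _ _ Dy) (dFE _ _ Dy).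
  have E z : odom D z -> spc b k (a *: v) z = (sfn a * spc b k v) z.
    by move=> Dz; rewrite spcZ.
  rewrite (derive_eq_on _ oD Dy E) deriveM.
  + by rewrite addrC; congr (_ + _); rewrite -[LHS]/(_ * _) mulrC.
  + exact/diff_derivable/diff_sfn.
  + exact/diff_derivable/diff_spc.
- move=> i j a; apply: sfun_eq => y Dy; rewrite sfnB sfn_sum.
  under eq_bigr do rewrite sfnM (dFE _ _ Dy).
  rewrite -(act_comm i j Dy (sfnP a)) !(dFE _ _ Dy).
  by congr (_ - _); apply: (derive_eq_on _ oD Dy) => z Dz; rewrite dFE.
- move=> i j v; apply: sspin_spc => y b k Dy; rewrite spcB spc_sum.
  under eq_bigr do rewrite spcZ // (dVFE _ _ _ _ Dy).
  rewrite -(act_comm i j Dy (Cinf_spc b k v)) !(dVFE _ _ _ _ Dy).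
  by congr (_ - _); apply: (derive_eq_on _ oD Dy) => z Dz; rewrite dVFE.
(* Tested on the coordinate functions, the hypothesis says that $\sum_k x_k e_k = 0$; pairing with
   $e_p$ by the metric isolates $x_p$. *)
- move=> x x0 p; apply: sfun_eq => y Dy; rewrite sfn0.
  have X0 : \sum_k sfn (x k) y *: e k y = 0.
    apply/rowP => l; rewrite summxE mxE.
    have := congr1 (fun a => sfn a y) (x0 (mk_sfun (Cinf_on_coord (odom D) l))).
    rewrite sfn0 sfn_sum => E; rewrite -[RHS]E; apply: eq_bigr => k _.
    rewrite sfnM [in LHS]mxE (dFE _ _ Dy); congr (_ * _).
    rewrite (derive_eq_on (g := fun z => z 0 l) _ oD Dy); last first.
      by move=> z Dz; rewrite mk_sfunE.
    have := derive_coord (Y := id) (e k y) l (y := y).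
    by rewrite derive_id => -> // l'; exact: differentiable_coord.
  have := congr1 (fun v => (v *m h y *m (e p y)^T) 0 0) X0.
  rewrite !mul0mx [in RHS]mxE !mulmx_suml summxE => E; rewrite -[RHS]E.
  rewrite (bigD1 p) //= -!scalemxAl mxE eON // eqxx mulr1 big1 ?addr0 // => k kp.
  by rewrite -!scalemxAl mxE eON // (negPf kp) mulr0.
- by move=> i v w; apply: sspin_eq => y Dy; rewrite sspD !(gFE _ _ Dy) sspD mulmxDr.
- move=> i a v; apply: sspin_eq => y Dy.
  by rewrite (gFE _ _ Dy) !(sspZ _ _ Dy) (gFE _ _ Dy) scalemxAr.
- move=> i j v; apply: sspin_spc => y b k Dy.
  rewrite (dVFE _ _ _ _ Dy) (gF_spc _ _ _ _ Dy).
  under eq_bigr do rewrite (dVFE _ _ _ _ Dy).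
  under [X in _ + X]eq_bigr do rewrite (dVFE _ _ _ _ Dy).
  rewrite (derive_eq_on _ oD Dy (fun z Dz => gF_spc j v b k Dz)).
  rewrite -!derive_lincomb; try by move=> l; exact: diff_spc.
  have dsum (z : 'I_N -> R) b' : differentiable (fun y => \sum_l z l * spc b' l v y) y.
    have dc l : differentiable (cst (z l) : 'rV[R]_n -> R) y.
      exact: differentiable_cst.
    by have [] := derive_sumM (index_enum _) 0 dc (fun l => diff_spc b' l v Dy).
  by rewrite -deriveD //; apply: diff_derivable; exact: dsum.
- move=> i j v; apply: sspin_eq => y Dy.
  rewrite sspD (sspZ _ _ Dy) !(gFE _ _ Dy) !mulmxA -mulmxDl gmC.
  rewrite mul_scalar_mx; congr (_ *: _).
  rewrite sfnN sfnM (sfn_nat _ Dy) (sfn_nat _ Dy) mulNr rmorphN rmorphM.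
  by rewrite !rmorph_nat.
Qed.

End Frame.

(** * The geometric operators in terms of the frame calculus *)

Section Representation.
Variables (R : realType) (n N : nat) (D : open_dom R n).
Variables (h : 'rV[R]_n -> 'M[R]_n) (e : 'I_n -> 'rV[R]_n -> 'rV[R]_n).
Variable (gm : 'I_n -> 'M[R[i]]_N).
Hypothesis hS : forall i j, Cinf_on D (fun y => h y i j).
Hypothesis eS : forall i j, Cinf_on D (fun y => e i y 0 j).
Hypothesis eON : forall i j y, odom D y ->
  (e i y *m h y *m (e j y)^T) 0 0 = (i == j)%:R.
Hypothesis gmC : forall i j,
  gm i *m gm j + gm j *m gm i = ((- 2) * (i == j)%:R)%:M.

Let oD := @odom_open _ _ D.
Let fa := frame_fa hS eS eON gmC.

Local Notation dF := (dF eS).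
Local Notation dVF := (dVF eS).
Local Notation gF := (gF gm).
Local Notation cF := (cF hS eS).

Definition half_sfun : sfun D := mk_sfun (Cinf_on_cst (odom D) 2^-1).

Lemma half_sfunE y : odom D y -> sfn half_sfun y = 2^-1.
Proof. by move=> Dy; rewrite mk_sfunE. Qed.

Lemma two_half_sfun : 2 * half_sfun = 1.
Proof.
apply: sfun_eq => y Dy; rewrite sfnM (sfn_nat _ Dy) (half_sfunE Dy) (sfn1 Dy).
by rewrite mulfV // pnatr_eq0.
Qed.

(** Agreement is asked on D only; it survives differentiation at points of D because D is open. *)
Definition repF (f : 'rV[R]_n -> R) (a : sfun D) :=
  forall y, odom D y -> f y = sfn a y.
Definition repX (X : 'rV[R]_n -> 'rV[R]_n) (x : 'I_n -> sfun D) :=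
  forall y, odom D y -> X y = \sum_k sfn (x k) y *: e k y.
Definition repS (psi : 'rV[R]_n -> 'cV[R[i]]_N) (v : sspin D N) :=
  forall y, odom D y -> psi y = ssp v y.

Lemma repX_e k : repX (e k) (delta _ k).
Proof.
move=> y Dy; rewrite (bigD1 k) //= big1 ?addr0.
  by rewrite /delta eqxx (sfn_nat 1 Dy) scale1r.
by move=> i /negPf ik; rewrite /delta ik (sfn_nat 0 Dy) scale0r.
Qed.

Lemma repX_eq X x x' : repX X x -> (forall k, x k = x' k) -> repX X x'.
Proof.
by move=> Xx xx' y Dy; rewrite Xx //; apply: eq_bigr => k _; rewrite xx'.
Qed.

Lemma rep_inner X Y x y : repX X x -> repX Y y ->
  repF (inner h X Y) (\sum_k x k * y k).
Proof.
move=> Xx Yy z Dz; rewrite /inner Xx // Yy // !mulmx_suml summxE sfn_sum.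
have sE (a : R) (M : 'M[R]_1) : (a *: M) 0 0 = a * M 0 0 by rewrite mxE.
apply: eq_bigr => k _; rewrite linear_sum /= mulmx_sumr summxE (bigD1 k) //=.
rewrite -!scalemxAl linearZ /= -scalemxAr !sE eON // eqxx mulr1 sfnM.
rewrite big1 ?addr0 // => l lk.
by rewrite linearZ /= -?scalemxAl -scalemxAr -?scalemxAl !sE eON // eq_sym (negPf lk) !mulr0.
Qed.

Lemma rep_act X f x a : repX X x -> repF f a ->
  repF (act X f) (dact dF x a).
Proof.
move=> Xx fa' y Dy; rewrite /act (derive_eq_on _ oD Dy fa') Xx //.
rewrite derive_dir_sum; last exact: diff_sfn.
by rewrite sfn_sum; apply: eq_bigr => k _; rewrite sfnM (dFE _ _ _ Dy).
Qed.

Let coord_sfun l : sfun D := mk_sfun (Cinf_on_coord (odom D) l).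

Lemma dF_coord k l y : odom D y -> sfn (dF k (coord_sfun l)) y = e k y 0 l.
Proof.
move=> Dy; rewrite (dFE _ _ _ Dy).
rewrite (derive_eq_on (g := fun z => z 0 l) _ oD Dy); last first.
  by move=> z Dz; rewrite mk_sfunE.
have := derive_coord (Y := id) (e k y) l (y := y).
by rewrite derive_id => -> // l'; exact: differentiable_coord.
Qed.

(** The chart components of a represented field lie in the ring, those of $e_k$ being derivatives of
    the coordinates. This yields their smoothness and lets [dact_brac], applied to coordinate
    functions, identify the bracket. *)
Lemma repX_coord X x l : repX X x ->
  repF (fun y => X y 0 l) (\sum_k x k * dF k (coord_sfun l)).
Proof.
move=> Xx y Dy; rewrite Xx // summxE sfn_sum; apply: eq_bigr => k _.
by rewrite mxE sfnM dF_coord.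
Qed.

Lemma repX_diff X x y l : repX X x -> odom D y ->
  differentiable (fun y => X y 0 l) y.
Proof.
move=> /(repX_coord l) Xl Dy.
have CX : Cinf_on D (fun y => X y 0 l).
  by apply: Cinf_on_eq oD _ (sfnP (\sum_k x k * dF k (coord_sfun l))) => z Dz; rewrite Xl.
exact: Cinf_on_diff CX Dy.
Qed.

Lemma rep_bracket X Y x y : repX X x -> repX Y y ->
  repX (bracket X Y) (brac dF cF x y).
Proof.
move=> Xx Yy z Dz; apply/rowP => l.
rewrite /bracket !mxE !derive_coord; try by move=> ?; apply: repX_diff Dz; eassumption.
rewrite [LHS](_ : _ = sfn (dact dF x (\sum_k y k * dF k (coord_sfun l))
    - dact dF y (\sum_k x k * dF k (coord_sfun l))) z); last first.
  rewrite sfnB -(rep_act Xx (repX_coord l Yy) Dz).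
  by rewrite -(rep_act Yy (repX_coord l Xx) Dz).
rewrite (dact_brac fa) sfn_sum summxE; apply: eq_bigr => k _.
by rewrite sfnM dF_coord // [RHS]mxE.
Qed.

Lemma repF_eq f a b : repF f a -> a = b -> repF f b.
Proof. by move=> + <-. Qed.

Lemma rep_koszul X Y x y k : repX X x -> repX Y y ->
  repF (koszul h X Y (e k)) (lcv dF cF half_sfun x y k).
Proof.
move=> Xx Yy z Dz; have ek := repX_e k.
rewrite -(koszul_delta fa two_half_sfun) sfnM (half_sfunE Dz) /koszul; congr (_ * _).
rewrite !(sfnD, sfnN).
rewrite (rep_act Xx (rep_inner Yy ek) Dz) (rep_act Yy (rep_inner ek Xx) Dz).
rewrite (rep_act ek (rep_inner Xx Yy) Dz) (rep_inner (rep_bracket Xx Yy) ek Dz).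
rewrite (rep_inner (rep_bracket Yy ek) Xx Dz).
by rewrite (rep_inner (rep_bracket ek Xx) Yy Dz).
Qed.

Lemma rep_levi_civita X Y x y : repX X x -> repX Y y ->
  repX (levi_civita h e X Y) (lcv dF cF half_sfun x y).
Proof.
move=> Xx Yy z Dz; apply: eq_bigr => k _.
by rewrite (rep_koszul _ Xx Yy Dz).
Qed.

Local Notation Gam := (christoffel cF half_sfun).

Lemma rep_levi_civita_e i j : repX (levi_civita h e (e i) (e j)) (Gam i j).
Proof.
apply: repX_eq (rep_levi_civita (repX_e i) (repX_e j)) _ => k.
exact: (lcv_delta fa).
Qed.

Lemma rep_christoffel i j k : repF (inner h (levi_civita h e (e i) (e j)) (e k)) (Gam i j k).
Proof.
apply: repF_eq (rep_inner (rep_levi_civita_e i j) (repX_e k)) _.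
exact: sum_deltar.
Qed.

Lemma rep_riem i j k : repX (riem h e (e i) (e j) (e k)) (curv dF cF half_sfun i j k).
Proof.
apply: (repX_eq (x := fun l => lcv dF cF half_sfun (delta _ i) (Gam j k) l
    - lcv dF cF half_sfun (delta _ j) (Gam i k) l
    - lcv dF cF half_sfun (cF i j) (delta _ k) l)); last first.
  by move=> l; exact: (curv_lcv fa half_sfun).
have bij : repX (bracket (e i) (e j)) (cF i j).
  by move=> y Dy; exact: (bracket_cF hS eS eON).
move=> y Dy; rewrite /riem.
rewrite (rep_levi_civita (repX_e i) (rep_levi_civita_e j k) Dy).
rewrite (rep_levi_civita (repX_e j) (rep_levi_civita_e i k) Dy).
rewrite (rep_levi_civita bij (repX_e k) Dy) -!sumrB.
by apply: eq_bigr => l _; rewrite !sfnB !scalerBl.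
Qed.

Lemma rep_curv i j k l :
  repF (inner h (riem h e (e i) (e j) (e k)) (e l)) (curv dF cF half_sfun i j k l).
Proof.
apply: repF_eq (rep_inner (rep_riem i j k) (repX_e l)) _.
exact: sum_deltar.
Qed.

Lemma rep_ric j k : repF (ric h e (e j) (e k)) (ricci dF cF half_sfun j k).
Proof.
move=> y Dy; rewrite sfn_sum; apply: eq_bigr => i _.
exact: rep_curv.
Qed.

Lemma rep_scal : repF (scal h e) (scalar dF cF half_sfun).
Proof.
by move=> y Dy; rewrite sfn_sum; apply: eq_bigr => k _; exact: rep_ric.
Qed.

Lemma rep_nabla i psi v : repS psi v ->
  repS (nabla h e gm (e i) psi) (nab dVF gF cF half_sfun i v).
Proof.
move=> pv y Dy; rewrite /nabla sspD; congr (_ + _).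
  apply/colP => k; apply: cpart_eq => b; rewrite cpart_act_spin -/(spc b k _ y).
  rewrite (dVFE _ _ _ _ _ Dy); apply: (derive_eq_on _ oD Dy) => z Dz.
  by rewrite pv.
rewrite /quad (sspZ _ _ Dy) sfnM (half_sfunE Dy) ssp_sum.
congr (_ *: _); first by congr (_%:C%C); rewrite -invfM -natrM.
apply: eq_bigr => j _; rewrite ssp_sum; apply: eq_bigr => k _.
rewrite (sspZ _ _ Dy) !(gFE _ _ _ Dy) -(rep_christoffel i j k Dy) -mulmxA.
by rewrite pv.
Qed.

Lemma rep_dirac psi v : repS psi v ->
  repS (dirac h e gm psi) (dir dVF gF cF half_sfun v).
Proof.
move=> pv y Dy; rewrite ssp_sum; apply: eq_bigr => i _.
by rewrite (gFE _ _ _ Dy) (rep_nabla _ pv Dy).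
Qed.

Lemma rep_cl_grad f a psi v : repF f a -> repS psi v ->
  repS (cl_grad e gm f psi) (clm gF (fun i => dF i a) v).
Proof.
move=> fr pv y Dy; rewrite ssp_sum; apply: eq_bigr => i _.
rewrite (sspZ _ _ Dy) (gFE _ _ _ Dy) -pv // (dFE _ _ _ Dy).
by rewrite /act (derive_eq_on _ oD Dy fr).
Qed.

Lemma rep_cl_ric_nabla psi v : repS psi v ->
  repS (cl_ric_nabla h e gm psi) (clric dF dVF gF cF half_sfun v).
Proof.
move=> pv y Dy; rewrite ssp_sum; apply: eq_bigr => i _.
rewrite ssp_sum; apply: eq_bigr => j _.
by rewrite (sspZ _ _ Dy) (gFE _ _ _ Dy) (rep_ric i j Dy) (rep_nabla _ pv Dy).
Qed.

Definition inv_n1 : sfun D := mk_sfun (Cinf_on_cst (odom D) (n%:R - 1)^-1).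
Definition inv_n2 : sfun D := mk_sfun (Cinf_on_cst (odom D) (n%:R - 2)^-1).

Lemma rep_L1 psi v : repS psi v ->
  repS (L1_loc h e gm psi) (L1a dF dVF gF cF half_sfun inv_n1 inv_n2 v).
Proof.
move=> pv y Dy; rewrite /L1_loc /L1a.
rewrite (rep_dirac (rep_dirac (rep_dirac pv)) Dy) (rep_cl_grad rep_scal pv Dy).
rewrite (rep_cl_ric_nabla pv Dy) (rep_dirac pv Dy) (rep_scal Dy).
rewrite !(sspD, sspN) !(sspZ _ _ Dy) !sfnM (half_sfunE Dy) !mk_sfunE // (sfn_nat _ Dy).
by rewrite !invfM mulrA.
Qed.

End Representation.

(** * Conformal covariance in one trivialisation *)

Section LocalConformal.
Variables (R : realType) (n N : nat) (D : open_dom R n).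
Variables (h : 'rV[R]_n -> 'M[R]_n) (e : 'I_n -> 'rV[R]_n -> 'rV[R]_n).
Variable (gm : 'I_n -> 'M[R[i]]_N).
Hypothesis n3 : (3 <= n)%N.
Hypothesis hS : forall i j, Cinf_on D (fun y => h y i j).
Hypothesis eS : forall i j, Cinf_on D (fun y => e i y 0 j).
Hypothesis eON : forall i j y, odom D y ->
  (e i y *m h y *m (e j y)^T) 0 0 = (i == j)%:R.
Hypothesis gmC : forall i j,
  gm i *m gm j + gm j *m gm i = ((- 2) * (i == j)%:R)%:M.
Variable w : 'rV[R]_n -> R.
Hypothesis wS : Cinf_on D w.

Let oD := @odom_open _ _ D.

Let h' y := expR (2 * w y) *: h y.
Let e' i y := expR (- w y) *: e i y.

Lemma Cinf_expZ (s : R) : Cinf_on D (fun y => expR (s * w y)).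
Proof. by apply: Cinf_on_expR => //; apply: Cinf_onM => //; exact: Cinf_on_cst. Qed.

Lemma conf_hS i j : Cinf_on D (fun y => h' y i j).
Proof.
apply: (Cinf_on_eq oD _ (Cinf_onM oD (Cinf_expZ 2) (hS i j))) => y _.
by rewrite [RHS]mxE.
Qed.

Lemma conf_eS i j : Cinf_on D (fun y => e' i y 0 j).
Proof.
apply: (Cinf_on_eq oD _ (Cinf_onM oD (Cinf_expZ (-1)) (eS i j))) => y _.
by rewrite [RHS]mxE mulN1r.
Qed.

Lemma conf_eON i j y : odom D y ->
  (e' i y *m h' y *m (e' j y)^T) 0 0 = (i == j)%:R.
Proof.
move=> Dy; rewrite /e' /h' [(_ *: e j y)^T]linearZ /= -!(scalemxAl, scalemxAr).
have sE (a : R) (M : 'M[R]_1) : (a *: M) 0 0 = a * M 0 0 by rewrite mxE.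
rewrite !sE eON // !mulrA -!expRD (_ : _ + _ = 0) ?expR0 ?mul1r //.
by ring.
Qed.

Lemma dF_expR (s : R) i :
  dF eS i (mk_sfun (Cinf_expZ s)) =
  mk_sfun (Cinf_on_cst (odom D) s) * (mk_sfun (Cinf_expZ s) * dF eS i (mk_sfun wS)).
Proof.
apply: sfun_eq => y Dy; rewrite !sfnM !(dFE _ _ _ Dy) !mk_sfunE //.
have dsw : differentiable (fun y => s * w y) y.
  by apply: Cinf_on_diff Dy; apply: Cinf_onM => //; exact: Cinf_on_cst.
have [_ E] := derive_expR_comp (e i y) dsw.
rewrite (derive_eq_on (g := expR \o (fun y => s * w y)) _ oD Dy).
  rewrite E mulrCA; congr (_ * _).
  have dw : derivable w y (e i y) by apply: diff_derivable; exact: Cinf_on_diff wS Dy.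
  rewrite [RHS](_ : _ = s * 'D_(e i y) w y); first exact: (deriveZ s dw).
  congr (_ * _); apply: (derive_eq_on _ oD Dy).
  by move=> z Dz; rewrite mk_sfunE.
by move=> z Dz; rewrite mk_sfunE.
Qed.

Let u := mk_sfun (Cinf_expZ (-1)).

(** An equality of operators, so that rewriting turns the axioms for the rescaled frame into those
    for the primed data of [conf_L1]. *)
Lemma conf_dF : dF conf_eS = fun i a => u * dF eS i a.
Proof.
apply/funext => i; apply/funext => a; apply: sfun_eq => y Dy.
rewrite sfnM !(dFE _ _ _ Dy) mk_sfunE // /e'.
have da := diff_sfn a Dy.
by rewrite !deriveE // linearZ /= mulN1r.
Qed.

Lemma conf_dVF : @dVF R n N D e' conf_eS = fun i v => u *: dVF eS i v.
Proof.
apply/funext => i; apply/funext => v; apply: sspin_spc => y b k Dy.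
rewrite (spcZ _ _ _ _ Dy) !(dVFE _ _ _ _ _ Dy) mk_sfunE // /e'.
have dv := diff_spc b k v Dy.
by rewrite !deriveE // linearZ /= mulN1r.
Qed.

Lemma local_conformal psi y : Cinf_spin D psi -> odom D y ->
  L1_loc h' e' gm psi y = (expR (- ((n%:R + 3) / 2) * w y))%:C%C *:
    L1_loc h e gm (fun z => (expR ((n%:R - 3) / 2 * w z))%:C%C *: psi z) y.
Proof.
move=> Cpsi Dy; pose v := mk_sspin Cpsi.
have pv : repS psi v by move=> z Dz; rewrite mk_sspinE.
pose s : R := (n%:R - 3) / 2.
pose f := mk_sfun (Cinf_expZ s); pose fi := mk_sfun (Cinf_expZ (- s)).
have pfv : repS (fun z => (expR (s * w z))%:C%C *: psi z) (f *: v).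
  by move=> z Dz; rewrite sspZ // mk_sspinE // mk_sfunE.
rewrite (rep_L1 conf_hS conf_eS conf_eON gmC pv Dy).
rewrite (rep_L1 hS eS eON gmC pfv Dy) conf_dF conf_dVF.
have fa := frame_fa hS eS eON gmC.
have := frame_fa conf_hS conf_eS conf_eON gmC.
rewrite conf_dF conf_dVF => fa'.
have n1 : n%:R - 1 != 0 :> R.
  by rewrite subr_eq0 (eqr_nat R n 1); case: (n) n3 => [|[|]].
have n2 : n%:R - 2 != 0 :> R.
  by rewrite subr_eq0 (eqr_nat R n 2); case: (n) n3 => [|[|[|]]].
have h3E : 3 * mk_sfun (Cinf_on_cst (odom D) 3^-1) = 1.
  apply: sfun_eq => z Dz; rewrite sfnM (sfn_nat _ Dz) mk_sfunE // (sfn1 Dz).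
  by rewrite mulfV // pnatr_eq0.
have q1E : inv_n1 D * (n%:R - 1) = 1.
  apply: sfun_eq => z Dz; rewrite sfnM sfnB (sfn_nat _ Dz) mk_sfunE // !(sfn1 Dz).
  by rewrite mulVf.
have q2E : inv_n2 D * (n%:R - 2) = 1.
  apply: sfun_eq => z Dz; rewrite sfnM sfnB !(sfn_nat _ Dz) mk_sfunE // !(sfn1 Dz).
  by rewrite mulVf.
have mE : mk_sfun (Cinf_on_cst (odom D) s) = half_sfun D * (n%:R - 3).
  apply: sfun_eq => z Dz; rewrite sfnM sfnB !(sfn_nat _ Dz) half_sfunE // mk_sfunE //.
  by rewrite mulrC.
have ffi : fi * f = 1.
  apply: sfun_eq => z Dz; rewrite sfnM !mk_sfunE // (sfn1 Dz) -expRD.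
  by rewrite mulNr addNr expR0.
have du i : dF eS i u = - (u * dF eS i (mk_sfun wS)).
  rewrite dF_expR -[RHS]mulN1r; congr (_ * _).
  by apply: sfun_eq => z Dz; rewrite mk_sfunE // sfnN (sfn1 Dz).
have df i : dF eS i f = half_sfun D * (n%:R - 3) * (f * dF eS i (mk_sfun wS)).
  by rewrite dF_expR mE.
rewrite (conf_L1 fa fa' du (two_half_sfun D) h3E q1E q2E df ffi).
rewrite (sspZ _ _ Dy); congr (_%:C%C *: _).
(* The three factors u and the factor [fi] contribute -3 - (n - 3)/2 = -(n + 3)/2. *)
rewrite !sfnM !mk_sfunE // -!expRD; congr expR.
by rewrite /s; field.
Qed.

End LocalConformal.

(** * Naturality *)

Section NaturalExpressions.
Variable R : realType.

Definition perm_of_tuple k (t : k.-tuple 'I_k) (ut : uniq t) : {perm 'I_k} :=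
  perm (elimT (tuple_uniqP t) ut).

Definition o4 (i : nat) : 'I_4 := inord i.
Definition o6 (i : nat) : 'I_6 := inord i.

Lemma uniq4 : uniq [tuple o4 0; o4 2; o4 3; o4 1].
Proof. by rewrite /= !inE -!val_eqE /= !inordK. Qed.

Lemma uniq6 : uniq [tuple o6 0; o6 2; o6 4; o6 1; o6 3; o6 5].
Proof. by rewrite /= !inE -!val_eqE /= !inordK. Qed.

Definition nat_dirac : natexp R 0 0 :=
  nat_comp (nat_contract R 0) (nat_comp (nat_cl R 1) (nat_nabla R 0)).

(* The permutations bring the indices to be contracted next to each other:
   1st and 4th, 2nd and 3rd of R_kiik here; in R_kijk g_i nabla_j below,
   1st and 4th, 2nd and 5th, 3rd and 6th. *)
Definition nat_scal : natexp R 0 0 :=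
  nat_comp (nat_contract R 0) (nat_comp (nat_contract R 2)
    (nat_comp (nat_perm R (perm_of_tuple uniq4)) (nat_riem R 0))).

Definition nat_cl_ric_nabla : natexp R 0 0 :=
  nat_comp (nat_contract R 0) (nat_comp (nat_contract R 2)
    (nat_comp (nat_contract R 4) (nat_comp (nat_perm R (perm_of_tuple uniq6))
      (nat_comp (nat_riem R 2) (nat_comp (nat_cl R 1) (nat_nabla R 0)))))).

(* cl(d scal) is the commutator of D with scal. *)
Definition nat_L1 n : natexp R 0 0 :=
  let D := nat_dirac in let S := nat_scal in
  nat_add (nat_add (nat_add (nat_comp D (nat_comp D D))
    (nat_scale (- (2 * (n%:R - 1))^-1)
       (nat_add (nat_comp D S) (nat_scale (-1) (nat_comp S D)))))
    (nat_scale (- (2 / (n%:R - 2))) nat_cl_ric_nabla))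
    (nat_scale ((n%:R - 1) * (n%:R - 2))^-1 (nat_comp S D)).

Variables (n N : nat).
Variables (h : 'rV[R]_n -> 'M[R]_n) (e : 'I_n -> 'rV[R]_n -> 'rV[R]_n).
Variable (gm : 'I_n -> 'M[R[i]]_N).
Local Notation eval := (nateval h e gm).

Lemma tnabla0 (psi : 'rV[R]_n -> 'cV[R[i]]_N) (J : 1.-tuple 'I_n) :
  tnabla h e gm (fun=> psi) J = nabla h e gm (e (thead J)) psi.
Proof. by apply/funext => y; rewrite /tnabla big_ord0 subr0. Qed.

Lemma eval_dirac psi : eval nat_dirac (fun=> psi) = fun=> dirac h e gm psi.
Proof.
apply/funext => J; apply/funext => y; rewrite (tuple0 J) /= /tcontract.
by apply: eq_bigr => i _; rewrite /tcl tnabla0.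
Qed.

Lemma eval_scal psi : eval nat_scal (fun=> psi) =
  fun=> fun y => (scal h e y)%:C%C *: psi y.
Proof.
apply/funext => J; apply/funext => y; rewrite (tuple0 J) /= /tcontract.
rewrite rmorph_sum scaler_suml; apply: eq_bigr => k _.
rewrite rmorph_sum scaler_suml; apply: eq_bigr => i _.
rewrite /tperm /triem.
have -> : [tuple tnth [tuple of i :: i :: [tuple of k :: k :: [tuple]]]
    (perm_of_tuple uniq4 r) | r < 4] = [tuple i; k; k; i].
  apply: eq_from_tnth => -[[|[|[|[|//]]]] r4]; rewrite tnth_mktuple permE;
    by rewrite !(tnth_nth i) /= inordK.
by [].
Qed.

Lemma eval_cl_ric_nabla psi : eval nat_cl_ric_nabla (fun=> psi) =
  fun=> cl_ric_nabla h e gm psi.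
Proof.
apply/funext => J; apply/funext => y; rewrite (tuple0 J) /= /tcontract.
(* The outermost contraction runs over the index of $\nabla$, so the two sums come in the opposite
   order. *)
rewrite /cl_ric_nabla [RHS]exchange_big; apply: eq_bigr => j _ /=.
apply: eq_bigr => i _.
rewrite rmorph_sum scaler_suml; apply: eq_bigr => k _.
rewrite /tperm /triem.
have -> : [tuple tnth [tuple of k :: k :: [tuple of i :: i :: [tuple of j :: j :: [tuple]]]]
    (perm_of_tuple uniq6 r) | r < 6] = [tuple k; i; j; k; i; j].
  apply: eq_from_tnth => -[[|[|[|[|[|[|//]]]]]] r6]; rewrite tnth_mktuple permE;
    by rewrite !(tnth_nth i) /= inordK.
rewrite /tcl tnabla0.
by [].
Qed.

Variable D : open_dom R n.
Hypothesis hS : forall i j, Cinf_on D (fun y => h y i j).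
Hypothesis eS : forall i j, Cinf_on D (fun y => e i y 0 j).
Hypothesis eON : forall i j y, odom D y ->
  (e i y *m h y *m (e j y)^T) 0 0 = (i == j)%:R.
Hypothesis gmC : forall i j,
  gm i *m gm j + gm j *m gm i = ((- 2) * (i == j)%:R)%:M.

Lemma local_natural psi y : Cinf_spin D psi -> odom D y ->
  L1_loc h e gm psi y = eval (nat_L1 n) (fun=> psi) [tuple] y.
Proof.
move=> Cpsi Dy; pose v := mk_sspin Cpsi.
have pv : repS psi v by move=> z Dz; rewrite mk_sspinE.
have psv : repS (fun y => (scal h e y)%:C%C *: psi y) (scalar (dF eS) (cF hS eS) (half_sfun D) *: v).
  by move=> z Dz; rewrite (sspZ _ _ Dz) (rep_scal hS eS eON gmC Dz) pv.
have E : cl_grad e gm (scal h e) psi y =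
    dirac h e gm (fun y => (scal h e y)%:C%C *: psi y) y
    - (scal h e y)%:C%C *: dirac h e gm psi y.
  rewrite (rep_dirac hS eS eON gmC psv Dy) (rep_dirac hS eS eON gmC pv Dy).
  rewrite (rep_cl_grad gm eS (rep_scal hS eS eON gmC) pv Dy).
  rewrite (dirZ (frame_fa hS eS eON gmC)) sspD (sspZ _ _ Dy).
  by rewrite (rep_scal hS eS eON gmC Dy) addrAC subrr add0r.
have evalD k l (a b : natexp R k l) T J : eval (nat_add a b) T J y =
  eval a T J y + eval b T J y by [].
have evalZ k l c (a : natexp R k l) T J : eval (nat_scale c a) T J y =
  c%:C%C *: eval a T J y by [].
have evalM k l p (a : natexp R l p) (b : natexp R k l) T :
  eval (nat_comp a b) T = eval a (eval b T) by [].
(* [evalM] is instantiated at the outer factors [nat_dirac] and [nat_scal], so that these, and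
   [nat_cl_ric_nabla], stay folded for their evaluation lemmas. *)
rewrite /nat_L1 !(evalD, evalZ)
  !(evalM _ _ _ nat_dirac, evalM _ _ _ nat_scal)
  !(eval_dirac, eval_scal, eval_cl_ric_nabla) /L1_loc E.
rewrite !rmorphN !scaleNr rmorph1 scale1r scalerA -rmorphM.
by rewrite [_ * scal _ _ _]mulrC.
Qed.

End NaturalExpressions.

Lemma Cinf_on_sub (R : realType) (m : nat) (U U' : set 'rV[R]_m) f :
  U' `<=` U -> Cinf_on U f -> Cinf_on U' f.
Proof.
move=> U'U Cf k; elim: k f {Cf}(Cf k) => [|k IH] f /=.
  by move=> cf y /U'U; exact: cf.
by move=> [df Df]; split=> [y /U'U|v]; [exact: df | exact: IH].
Qed.

(** * Manifolds *)

Section Trivialisation.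
Variables (R : realType) (n : nat) (S : spin_manifold R n).
Hypothesis spinS : is_spin_manifold S.
Variable a : triv S.
Let c := tchart a.

Lemma tdom_dom x : tdom a x -> dom c x.
Proof. by case: spinS => _ _ _ [_ /(_ a)[_ sub] _ _]; exact: sub. Qed.

Lemma param_coord x : tdom a x -> param c (coord c x) = x.
Proof.
by move=> /tdom_dom cx; case: spinS => -[_ _ _ /(_ c)[_ _ + _ _] _] _ _ _; exact.
Qed.

(** The image is the preimage of the open set [tdom a] under [param c], which is continuous on the
    open image of the whole chart. *)
Lemma open_coord_tdom : open (coord c @` tdom a).
Proof.
have [[_ _ _ /(_ c)[_ oc pc _ cp] _] _ _ [_ /(_ a)[ot _] _ _]] := spinS.
rewrite openE => y [x ax <-]; have cx := tdom_dom ax.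
move: cp; rewrite continuous_open_subspace // => /(_ (coord c x)).
rewrite inE => /(_ (ex_intro2 _ _ x cx erefl)) cpx.
have nt : \forall z \near coord c x, tdom a (param c z).
  by apply: cpx; rewrite pc //; exact: open_nbhs_nbhs.
have nc : \forall z \near coord c x, (coord c @` dom c) z.
  by apply: open_nbhs_nbhs; split => //; exists x.
rewrite /interior; apply: filterS2 nt nc => z az [x' cx' zx'].
by exists x' => //; rewrite -(pc x' cx') zx'.
Qed.

Definition tdom_chart : open_dom R n := OpenDom open_coord_tdom.

Lemma tdom_chartP y : odom tdom_chart y -> exists2 x, tdom a x & y = coord c x.
Proof. by move=> [x ax <-]; exists x. Qed.

Lemma smooth_on_tdom (W : set (carrier S)) f : tdom a `<=` W ->
  smooth_on W f -> Cinf_on tdom_chart (f \o param c).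
Proof.
move=> aW /(_ c); apply: Cinf_on_sub => _ [x ax <-].
by exists x => //; split; [exact: aW | exact: tdom_dom].
Qed.

Lemma loc_gram_smooth i j : Cinf_on tdom_chart (fun y => loc_gram a y i j).
Proof.
have [_ [gS _ _ _] _ _] := spinS.
exact: (smooth_on_tdom tdom_dom (gS c i j)).
Qed.

Lemma loc_frame_smooth i j : Cinf_on tdom_chart (fun y => loc_frame a i y 0 j).
Proof.
have [_ _ _ [_ _ /(_ a)[fS _] _]] := spinS.
exact: (smooth_on_tdom (@subset_refl _ _) (fS i j)).
Qed.

Lemma loc_frame_orthonormal i j y : odom tdom_chart y ->
  (loc_frame a i y *m loc_gram a y *m (loc_frame a j y)^T) 0 0 = (i == j)%:R.
Proof.
move=> /tdom_chartP[x ax ->]; have [_ _ _ [_ _ /(_ a)[_ fO] _]] := spinS.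
by rewrite /loc_frame /loc_gram param_coord // fO.
Qed.

Lemma spinor_smooth (psi : spinor_field S) : smooth_spinor psi ->
  Cinf_spin tdom_chart (psi a \o param c).
Proof.
move=> [sm _] k; have [re im] := sm a k.
by split; [exact: (smooth_on_tdom (@subset_refl _ _) re)
  | exact: (smooth_on_tdom (@subset_refl _ _) im)].
Qed.

End Trivialisation.

Theorem corollary3 (R : realType) (n : nat) (hn : (3 <= n)%N) :
  natural (@L1 R n) /\
  (forall S : spin_manifold R n, is_spin_manifold S ->
   forall omega : carrier S -> R, smooth_on setT omega ->
   forall psi : spinor_field S, smooth_spinor psi ->
     eq_spinor (@L1 R n (conformal omega) psi)
               (exp_mul (- ((n%:R + 3) / 2)) omega
                  (L1 (exp_mul ((n%:R - 3) / 2) omega psi)))).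
Proof.
split.
  exists (nat_L1 R n) => S spinS psi psiS a x ax.
  have [_ _ gC _] := spinS.
  apply: (local_natural (@loc_gram_smooth R n S spinS a)
    (@loc_frame_smooth R n S spinS a) (@loc_frame_orthonormal R n S spinS a) gC).
    exact: spinor_smooth.
  by exists x.
move=> S spinS omega omegaS psi psiS a x ax.
have [_ _ gC _] := spinS.
have wS : Cinf_on (tdom_chart spinS a) (omega \o param (tchart a)).
  exact: smooth_on_tdom omegaS.
have Dx : odom (tdom_chart spinS a) (coord (tchart a) x) by exists x.
(* With the factor read in the chart, [local_conformal] applies as it stands: the local Gram matrix
   and frame of [conformal omega] are convertible to its rescaled data. *)
rewrite /exp_mul (_ : omega x = (omega \o param (tchart a)) (coord (tchart a) x)).
  exact: (local_conformal hn (loc_gram_smooth spinS a)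
    (loc_frame_smooth spinS a) (@loc_frame_orthonormal R n S spinS a) gC wS
    (spinor_smooth spinS a psiS) Dx).
by rewrite /= param_coord.
Qed.
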